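(* Let $d\ge 2$ be an integer and let $\Omega := \{x=(x_1, \dots, x_d) \in \mathbb{R}^d: x_1<x_2<\dots<x_d\}$, a domain (open and connected) in $\mathbb{R}^d$. Then for all $u \in C_0^\infty(\Omega)$, $$\frac{(d^2-2)^2}{4}\int_{\Omega} \frac{|u(x)|^2}{|x|^2}\, dx \leq \int_{\Omega} |\nabla u(x)|^2\, dx.$$ Moreover, the constant $\frac{(d^2-2)^2}{4}$ is sharp, i.e. the inequality fails (for some $u\in C_0^\infty(\Omega)$) if it is replaced by any strictly larger constant.
   Context: $C_0^\infty(\Omega)$ denotes the space of smooth functions with compact support in $\Omega$; $|x|$ is the Euclidean norm. *)

(* Defs.v *)
From HB Require Import structures.
From mathcomp Require Import all_boot all_order all_algebra.
From mathcomp Require Import all_classical all_reals all_analysis.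
From mathcomp Require Import complex.

Set Implicit Arguments.
Unset Strict Implicit.
Unset Printing Implicit Defensive.

Import Order.TTheory GRing.Theory Num.Theory.
Import numFieldNormedType.Exports.

Local Open Scope classical_set_scope.
Local Open Scope ring_scope.

Section measurable_rV.
Context {R : realType} (n : nat).

Let coord : 'I_n -> 'rV[R]_n -> R := fun i x => x ord0 i.

Let rV_set0 : g_sigma_preimage coord set0.
Proof. exact: sigma_algebra0. Qed.

Let rV_setC A : g_sigma_preimage coord A -> g_sigma_preimage coord (~` A).
Proof. exact: sigma_algebraC. Qed.

Let rV_bigcup (F : _^nat) : (forall i, g_sigma_preimage coord (F i)) ->
  g_sigma_preimage coord (\bigcup_i (F i)).
Proof. exact: sigma_algebra_bigcup. Qed.

HB.instance Definition _ := @isMeasurable.Build default_measure_display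
  'rV[R]_n (g_sigma_preimage coord) rV_set0 rV_setC rV_bigcup.

Lemma measurable_coord (i : 'I_n) :
  measurable_fun [set: 'rV[R]_n] (fun x : 'rV[R]_n => x ord0 i).
Proof.
move=> _ Y mY; rewrite setTI; apply: sub_sigma_algebra => /=.
rewrite -bigcup_seq/=; exists i => /=; first by rewrite mem_index_enum.
by exists Y => //; rewrite setTI.
Qed.

Lemma measurable_fun_rVP d (T : measurableType d) (f : T -> 'rV[R]_n) :
  (forall i, measurable_fun [set: T] (fun t => f t ord0 i)) ->
  measurable_fun [set: T] f.
Proof.
move=> mf.
suff : g_sigma_preimage (fun i t => f t ord0 i) `<=` measurable.
  rewrite (g_sigma_preimage_comp (fun i (x : 'rV[R]_n) => x ord0 i : R)) => prefS _ A mA.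
  by apply: prefS; exists A.
apply: smallest_sub; first exact: sigma_algebra_measurable.
rewrite -bigcup_seq; apply: bigcup_sub => i _.
by move=> A [B mB <-]; exact: mf.
Qed.

End measurable_rV.

Section lebesgue_rV.
Context {R : realType}.

Definition rV_cons n (p : R * 'rV[R]_n) : 'rV[R]_n.+1 :=
  \row_i if unlift ord0 i is Some j then p.2 ord0 j else p.1.

Definition rV_uncons n (x : 'rV[R]_n.+1) : R * 'rV[R]_n :=
  (x ord0 ord0, \row_j x ord0 (lift ord0 j)).

Lemma rV_consE0 n (p : R * 'rV[R]_n) : rV_cons p ord0 ord0 = p.1.
Proof. by rewrite mxE unlift_none. Qed.

Lemma rV_consES n (p : R * 'rV[R]_n) j :
  rV_cons p ord0 (lift ord0 j) = p.2 ord0 j.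
Proof. by rewrite mxE liftK. Qed.

Lemma rV_consK n : cancel (@rV_cons n) (@rV_uncons n).
Proof.
move=> [t x]; rewrite /rV_uncons rV_consE0; congr pair.
by apply/rowP => j; rewrite mxE rV_consES.
Qed.

Lemma measurable_rV_cons n :
  measurable_fun [set: measurableTypeR R * 'rV[R]_n] (@rV_cons n).
Proof.
apply: measurable_fun_rVP => i; case: (unliftP ord0 i) => [j|] ->.
  under [X in measurable_fun _ X]eq_fun do rewrite rV_consES.
  exact: (measurableT_comp (measurable_coord j) measurable_snd).
under [X in measurable_fun _ X]eq_fun do rewrite rV_consE0.
exact: measurable_fst.
Qed.

Lemma measurable_rV_uncons n :
  measurable_fun [set: 'rV[R]_n.+1]
    (@rV_uncons n : _ -> measurableTypeR R * 'rV[R]_n).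
Proof.
apply/measurable_fun_pairP; split; first exact: measurable_coord.
apply: measurable_fun_rVP => j.
under [X in measurable_fun _ X]eq_fun do rewrite /= mxE.
exact: measurable_coord.
Qed.

Section step.
Variables (n : nat) (mu : {sigma_finite_measure set 'rV[R]_n -> \bar R}).

Definition lebesgue_rV_step : set 'rV[R]_n.+1 -> \bar R :=
  pushforward (@lebesgue_measure R \x mu)%E (@rV_cons n).

Let step0 : lebesgue_rV_step set0 = 0%E.
Proof. by rewrite /lebesgue_rV_step /pushforward preimage_set0 measure0. Qed.

Let step_ge0 A : (0 <= lebesgue_rV_step A)%E.
Proof. by rewrite /lebesgue_rV_step /pushforward measure_ge0. Qed.

Let step_sigma_additive : semi_sigma_additive lebesgue_rV_step.
Proof.
move=> F mF tF mUF; rewrite /lebesgue_rV_step /pushforward preimage_bigcup.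
apply: measure_semi_sigma_additive.
- by move=> k; rewrite -[X in measurable X]setTI; exact: measurable_rV_cons.
- apply/trivIsetP => /= i j _ _ ij; rewrite -preimage_setI.
  by move/trivIsetP : tF => /(_ _ _ _ _ ij) ->//; rewrite preimage_set0.
- rewrite -preimage_bigcup -[X in measurable X]setTI.
  exact: measurable_rV_cons.
Qed.

HB.instance Definition _ := isMeasure.Build _ _ _ lebesgue_rV_step
  step0 step_ge0 step_sigma_additive.

Let step_sigma_finite : sigma_finite setT lebesgue_rV_step.
Proof.
have /sigma_finiteP[F [FT ndF Foo]] := sigma_finiteT (@lebesgue_measure R).
have /sigma_finiteP[G [GT ndG Goo]] := sigma_finiteT mu.
exists (fun k => @rV_uncons n @^-1` (F k `*` G k)).
  rewrite -preimage_bigcup -[LHS](preimage_setT (@rV_uncons n)).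
  congr (_ @^-1` _); rewrite -setXTT FT GT predeqE => -[x y]; split.
    move=> [/= [i _ Fix] [j _ Gjy]]; exists (maxn i j) => //; split.
    - by move: x Fix; exact/subsetPset/ndF/leq_maxl.
    - by move: y Gjy; exact/subsetPset/ndG/leq_maxr.
  by move=> [i _ []/= ? ?]; split; exists i.
move=> k; have [mFk Fkoo] := Foo k; have [mGk Gkoo] := Goo k; split.
  rewrite -[X in measurable X]setTI; apply: measurable_rV_uncons => //.
  exact: measurableX.
rewrite /lebesgue_rV_step /pushforward -comp_preimage.
rewrite (_ : _ \o _ = idfun) ?preimage_id; last first.
  by apply/funext => x /=; exact: rV_consK.
by rewrite product_measure1E// lte_mul_pinfty// ge0_fin_numE.
Qed.

HB.instance Definition _ := Measure_isSigmaFinite.Build _ _ _ lebesgue_rV_step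
  step_sigma_finite.

End step.

(* d-dimensional Lebesgue measure as the d-fold product of the measure on R *)
Fixpoint lebesgue_rV (d : nat) :
    {sigma_finite_measure set 'rV[R]_d -> \bar R} :=
  if d is d'.+1 then lebesgue_rV_step (lebesgue_rV d') else \d_(0 : 'rV[R]_0).

Lemma lebesgue_rV_box d (A : 'I_d -> set (measurableTypeR R)) :
  (forall i, measurable (A i)) ->
  lebesgue_rV d [set x | forall i, A i (x ord0 i)] =
  (\prod_(i < d) lebesgue_measure (A i))%E.
Proof.
elim: d A => [|d IH] A mA.
  by rewrite big_ord0 /= diracE mem_set// => -[].
rewrite big_ord_recl -IH//= /lebesgue_rV_step /pushforward.
rewrite -product_measure1E//; last first.
  rewrite [X in measurable X](_ : _ = \bigcap_(i : 'I_d)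
      ((fun x : 'rV[R]_d => x ord0 i) @^-1` A (lift ord0 i))); last first.
    by apply/seteqP; split=> x /= Ax i => [_|]; exact: Ax.
  apply: fin_bigcap_measurable => // i _; rewrite -[X in measurable X]setTI.
  exact: (@measurable_coord R d i measurableT _ (mA _)).
congr (_ _); apply/seteqP; split => -[t x] /= Ax.
  by split=> [|i]; [have := Ax ord0|have := Ax (lift ord0 i)];
    rewrite ?rV_consE0 ?rV_consES.
by move=> i; case: (unliftP ord0 i) => [j|] ->;
  rewrite ?rV_consE0 ?rV_consES; case: Ax.
Qed.

End lebesgue_rV.

Section smooth_functions.
Context {R : realType} (d : nat).
Implicit Types (f : 'rV[R]_d -> R) (u : 'rV[R]_d -> R[i]) (x : 'rV[R]_d).

Definition enorm x : R := Num.sqrt (\sum_i x ord0 i ^+ 2).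

Definition partial (i : 'I_d) f : 'rV[R]_d -> R :=
  fun x => 'D_(delta_mx ord0 i) f x.

(* C^oo: every iterated partial derivative is (Frechet) differentiable
   everywhere, hence in particular continuous *)
Definition smooth f : Prop :=
  forall (s : seq 'I_d) x, differentiable (foldr partial f s) x.

Definition csmooth u : Prop :=
  smooth (fun x => complex.Re (u x)) /\ smooth (fun x => complex.Im (u x)).

(* Functions on Omega with compact support are identified with their extension
   by 0 to the whole space *)
Definition C0oo (Omega : set 'rV[R]_d) u : Prop :=
  let supp := closure [set x | u x != 0] in
  [/\ csmooth u, compact supp & supp `<=` Omega].

Definition cpartial (i : 'I_d) u x : R[i] :=
  (partial i (fun y => complex.Re (u y)) x +i*
   partial i (fun y => complex.Im (u y)) x)%C.

Definition gradnorm u x : R :=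
  Num.sqrt (\sum_i ComplexField.Normc.normc (cpartial i u x) ^+ 2).

End smooth_functions.

Definition weyl_chamber (R : realType) (d : nat) : set 'rV[R]_d :=
  [set x | forall i j : 'I_d, (i < j)%N -> x ord0 i < x ord0 j].
Arguments weyl_chamber : clear implicits.

(* Main.v *)
From HB Require Import structures.
Require Import Defs.
From mathcomp Require Import all_boot all_order all_algebra.
From mathcomp Require Import all_classical all_reals all_analysis.
From mathcomp Require Import measurable_realfun.
From mathcomp Require Import complex.
From mathcomp Require Import ring lra.

Set Implicit Arguments.
Unset Strict Implicit.
Unset Printing Implicit Defensive.

Import Order.TTheory GRing.Theory Num.Theory.
Import numFieldNormedType.Exports.

Local Open Scope classical_set_scope.
Local Open Scope ring_scope.

(** The proof rests on positive solutions of the Euler-Lagrange equation of the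
    Hardy quotient.

    The Vandermonde product [V = prod_(i < j) (x_j - x_i)] is harmonic, positive
    on the Weyl chamber and homogeneous of degree [d (d - 1) / 2]. Hence, with
    [a = (d^2 - 2) / 2], the function [w = |x|^(-a) V] is a positive solution of
    [- Laplacian w = a^2 w / |x|^2]. Equivalently, the field [F = grad w / w]
    satisfies the Riccati identity [div F + |F|^2 = - a^2 / |x|^2]
    ([riccati_weyl_field]). For a test function [u] one expands the nonnegative
    [|grad u - u F|^2] and obtains the pointwise bound
    [a^2 |u|^2 / |x|^2 + div (|u|^2 F) <= |grad u|^2]; the divergence integrates
    to zero ([divergence_theorem_csupp]), and this is the inequality
    ([hardy_weyl]).

    For sharpness, take [k > 0] and [v = |x|^(-a) V cos (k log |x|)]. It solves
    [- Laplacian v = (a^2 + k^2) v / |x|^2], is positive on the bounded domain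
    [D] of those points of the chamber where [k |log |x|| < pi / 2], and
    vanishes on the boundary of [D] ([riccati_oscillator]). Its superlevel sets
    [v >= e] are therefore compact in [D], so that [u = T_e (v)] is a test
    function when [T_e] is a smooth truncation vanishing on [s <= e], with
    [0 <= T_e' <= 1] and [s - 2 e <= T_e s]. No cutoff error has to be estimated:
    [|grad u|^2 <= T_e'(v) |grad v|^2], and the integral of the right-hand side
    is exactly that of [(a^2 + k^2) T_e (v) v / |x|^2] by the divergence theorem
    ([energy_extremal]). As [e] tends to 0 the Hardy quotient of [u] gets as
    close to [a^2 + k^2] as desired ([hardy_weyl_fails]), and [k] is
    arbitrarily small. *)

(** * Flat functions *)

Section flat_functions.
Context {R : realType}.

(** The polynomial factor is what makes the family stable under
    differentiation; [exp (-1/t)] alone is not. *)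
Definition flat (p : {poly R}) (t : R) : R :=
  if 0 < t then p.[t^-1] * expR (- t^-1) else 0.

(** With [y = 1/t], the power [y ^ i] is at most [i! exp y]. *)
Lemma flat_bounded p : exists2 C, 0 <= C & forall t, `|flat p t| <= C.
Proof.
exists (\sum_(i < size p) `|p`_i| * i`!%:R).
  by apply: sumr_ge0 => i _; rewrite mulr_ge0.
move=> t; rewrite /flat; case: ifPn => [t0|_]; last first.
  by rewrite normr0; apply: sumr_ge0 => i _; rewrite mulr_ge0.
have y0 : 0 < t^-1 by rewrite invr_gt0.
set y := t^-1 in y0 *.
rewrite horner_coef mulr_suml.
apply: le_trans (ler_norm_sum _ _ _) _.
apply: ler_sum => i _; rewrite !normrM -mulrA ler_wpM2l//.
rewrite (ger0_norm (expR_ge0 _)) ger0_norm ?exprn_ge0 ?(ltW y0)//.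
rewrite expRN ler_pdivrMr ?expR_gt0//.
case: i => -[|i] /= _.
  by rewrite fact0 mul1r expr0 -expR0 ler_expR ltW.
rewrite -ler_pdivrMl ?ltr0n ?fact_gt0// mulrC.
by apply: le_trans (expR_ge1Dxn i (ltW y0)); rewrite lerDr.
Qed.

Lemma flatMX p (t : R) : t * flat (p * 'X) t = flat p t.
Proof.
rewrite /flat; case: ifPn => [t0|]; last by rewrite mulr0.
by rewrite hornerMX; field; rewrite gt_eqF.
Qed.

(** Flatness at the origin, where [flat p t] is [t ^+ 2] times a bounded
    function, makes differentiation close on this family. *)
Lemma is_derive_flat p (t : R) :
  is_derive t 1 (flat p) (flat ('X^2 * (p - p^`())) t).
Proof.
have [t0|t0|->] := ltgtP t 0.
- have -> : flat ('X^2 * (p - p^`())) t = 0 by rewrite /flat ltNge ltW.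
  apply: (@near_eq_is_derive _ _ _ (cst 0) (flat p)).
  near=> s; rewrite /flat ifN// -leNgt ltW//; near: s.
  by apply: open_nbhs_nbhs; split; [exact: open_lt|].
- rewrite [X in is_derive _ _ _ X]/flat t0.
  pose g (s : R) := p.[s^-1] * expR (- s^-1).
  apply: (@near_eq_is_derive _ _ _ g (flat p)).
    near=> s; rewrite /flat ifT//; near: s.
    by apply: open_nbhs_nbhs; split; [exact: open_gt|].
  have tn0 : t != 0 by rewrite gt_eqF.
  have dV : is_derive t 1 (fun s : R => s^-1) (- t ^- 2).
    have -> : - t ^- 2 = - t ^- 2 *: (1 : R) by rewrite scaler1.
    exact: (is_deriveV (f := id)).
  have d1 : is_derive t 1 (fun s : R => p.[s^-1]) (- t ^- 2 * p^`().[t^-1]).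
    rewrite mulrC.
    by apply: (@is_derive1_comp _ (horner p) (fun s : R => s^-1)).
  have d2 : is_derive t 1 (fun s : R => expR (- s^-1))
              (t ^- 2 * expR (- t^-1)).
    rewrite -[t ^- 2]opprK mulrC.
    by apply: (@is_derive1_comp _ expR (fun s : R => - s^-1)).
  apply: is_derive_eq.
  rewrite hornerM hornerXn hornerD hornerN /GRing.scale /=; field; exact: tn0.
- rewrite [X in is_derive _ _ _ X]/flat ltxx.
  have [C C0 hC] := flat_bounded (p * 'X * 'X).
  suff h : (fun h : R => h^-1 *: (flat p (h *: (1 : R) + 0) - flat p 0))
      @ (0 : R)^' --> (0 : R).
    split; first by apply/cvg_ex; exists 0.
    exact: cvg_lim h.
  have nrm0 : `|h| @[h --> (0 : R)^'] --> (0 : R).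
    apply: cvg_within_filter.
    by have /= := @norm_continuous _ R (0 : R); rewrite /continuous_at normr0.
  apply: (@squeeze_cvgr _ _ _ _ (fun h : R => - (C * `|h|))
    (fun h : R => C * `|h|)).
  + near=> h; rewrite -ler_norml addr0 [flat p 0]/flat ltxx subr0 scaler1.
    rewrite -[flat p h]flatMX -[flat (p * 'X) h]flatMX /GRing.scale /=.
    have h0 : h != 0 by near: h; exact: nbhs_dnbhs_neq.
    by rewrite mulKf// normrM mulrC ler_wpM2r.
  + rewrite -[X in _ --> X]oppr0; apply: cvgN.
    rewrite -[X in _ --> X](mulr0 C); apply: cvgM; first exact: cvg_cst.
    exact: nrm0.
  + rewrite -[X in _ --> X](mulr0 C); apply: cvgM; first exact: cvg_cst.
    exact: nrm0.
Unshelve. all: by end_near. Qed.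

End flat_functions.

(** * Calculus of smooth functions *)

Section smooth_calculus.
Context {R : realType}.

(** Differentiability is local. The differential of [f] serves for [g]. *)
Lemma near_eq_differentiable (V W : normedModType R) (f g : V -> W) (x : V) :
  (\near x, f x = g x) -> differentiable f x -> differentiable g x.
Proof.
move=> fg df.
have [cf ef] := (diff_locallyP x f).1 df.
have ec : g \o shift x = cst (g x) + 'd f x +o_ 0 id.
  apply/eqaddoP => e e0.
  move/eqaddoP : ef => /(_ e e0) ef.
  have fgx : f x = g x := nbhs_singleton fg.
  have fg0 : \forall y \near 0, f (y + x) = g (y + x).
    move: fg; rewrite (near_shift 0)/=.
    by apply: filterS => y; rewrite subr0.
  near=> y.
  have -> : (g \o shift x - (cst (g x) + 'd f x)) y
     = (f \o shift x - (cst (f x) + 'd f x)) y.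
    rewrite !fctE /= fgx; congr (_ - _).
    by apply/esym; near: y.
  by near: y.
have eg := diff_unique cf ec.
apply/diff_locallyP; split.
  by move=> y; rewrite eg; exact: cf.
by rewrite eg.
Unshelve. all: by end_near. Qed.

Context {d : nat}.
Implicit Types (f g : 'rV[R]_d -> R) (D : set 'rV[R]_d).

Definition smooth_on D f :=
  forall (s : seq 'I_d) x, D x -> differentiable (foldr (@partial R d) f s) x.

Lemma partialE f x i : differentiable f x ->
  partial i f x = 'd f x (delta_mx ord0 i).
Proof. by move=> df; rewrite /partial deriveE. Qed.

Lemma partialD f g i x : differentiable f x -> differentiable g x ->
  partial i (f \+ g) x = partial i f x + partial i g x.
Proof. by move=> df dg; rewrite /partial deriveD//; exact: diff_derivable. Qed.

Lemma partialM f g i x : differentiable f x -> differentiable g x ->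
  partial i (f \* g) x = f x * partial i g x + g x * partial i f x.
Proof. by move=> df dg; rewrite /partial deriveM//; exact: diff_derivable. Qed.

Lemma differentiable_comp1 (g : R -> R) dg f x : differentiable f x ->
  is_derive (f x) 1 g dg -> differentiable (g \o f) x.
Proof.
move=> df [gd _]; apply: differentiable_comp => //.
exact/derivable1_diffP.
Qed.

Lemma partial_comp (g : R -> R) dg f i x : differentiable f x ->
  is_derive (f x) 1 g dg -> partial i (g \o f) x = dg * partial i f x.
Proof.
move=> df gdg; have dgf := differentiable_comp1 df gdg.
have [gd <-] := gdg.
have dg1 : differentiable g (f x) by exact/derivable1_diffP.
rewrite !partialE// diff_comp//= diff1E// derive1E /GRing.scale /=.
by rewrite mulrC.
Qed.

Lemma partialV f i x : differentiable f x -> f x != 0 ->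
  differentiable (fun y => (f y)^-1) x /\
  partial i (fun y => (f y)^-1) x = - (f x) ^- 2 * partial i f x.
Proof.
move=> df f0; split; first exact: differentiableV.
by rewrite /partial deriveV//; exact: diff_derivable.
Qed.

Lemma partial_cM (c : R) f i x : differentiable f x ->
  differentiable (fun y => c * f y) x /\
  partial i (fun y => c * f y) x = c * partial i f x.
Proof.
move=> df; have dc := differentiable_cst c x.
split; first exact: differentiableM.
by rewrite (partialM i dc df) /partial derive_cst mulr0 addr0.
Qed.

Lemma partial_sum (I : finType) (P : pred I) (f : I -> 'rV[R]_d -> R) i x :
  (forall j, P j -> differentiable (f j) x) ->
  differentiable (fun y => \sum_(j | P j) f j y) x /\
  partial i (fun y => \sum_(j | P j) f j y) x =
    \sum_(j | P j) partial i (f j) x.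
Proof.
move=> df.
rewrite (_ : (fun y => _) = \sum_(j | P j) f j); last first.
  by apply/funext => y; rewrite fct_sumE.
elim/big_rec2: _ => [|j g h Pj [dh <-]].
  by split; [exact: differentiable_cst|rewrite /partial derive_cst].
split; first by apply: differentiableD => //; exact: df.
by rewrite -partialD//; exact: df.
Qed.

Lemma partial_prod (I : finType) (P : pred I) (f : I -> 'rV[R]_d -> R) i x :
  (forall j, P j -> differentiable (f j) x) -> (forall j, P j -> f j x != 0) ->
  differentiable (fun y => \prod_(j | P j) f j y) x /\
  partial i (fun y => \prod_(j | P j) f j y) x =
  (\prod_(j | P j) f j x) * \sum_(j | P j) partial i (f j) x / f j x.
Proof.
move=> df f0.
rewrite (_ : (fun y => _) = \prod_(j | P j) f j); last first.
  by apply/funext => y; rewrite fct_prodE.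
suff [] : (\prod_(j | P j) f j) x = \prod_(j | P j) f j x /\
    differentiable (\prod_(j | P j) f j) x /\
    partial i (\prod_(j | P j) f j) x =
      (\prod_(j | P j) f j x) * \sum_(j | P j) partial i (f j) x / f j x by [].
apply: (big_rec3 (fun (A : 'rV[R]_d -> R) (b c : R) =>
  A x = b /\ differentiable A x /\ partial i A x = b * c)).
  split=> //; split; first exact: differentiable_cst.
  by rewrite /partial derive_cst mulr0.
move=> j A b c Pj [<- [dA e]]; split => //.
split; first by apply: differentiableM => //; exact: df.
rewrite (partialM i (df j Pj) dA) e; field; exact: f0.
Qed.

Lemma partial_coord (i j : 'I_d) (x : 'rV[R]_d) :
  partial i (fun y => y ord0 j) x = (i == j)%:R.
Proof.
rewrite partialE; last exact: differentiable_coord.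
pose c (y : 'rV[R]_d) : R := y ord0 j.
have lc : linear c by move=> k u v; rewrite /c !mxE.
pose mc := GRing.isLinear.Build _ _ _ _ _ lc.
pose L : {linear _ -> _} := HB.pack c mc.
rewrite -[fun y => _]/(L : _ -> _) diff_lin; last first.
  exact: coord_continuous.
by rewrite /L /c /= mxE eqxx /= eq_sym.
Qed.

Lemma partial_near f g i x : (\near x, f x = g x) ->
  partial i f x = partial i g x.
Proof. exact: near_eq_derive. Qed.

Lemma open_near_eq D f g x : open D -> D x -> (forall y, D y -> f y = g y) ->
  \near x, f x = g x.
Proof.
move=> oD Dx fg; have : nbhs x D by exact: open_nbhs_nbhs.
by apply: filterS => y; exact: fg.
Qed.

(** The functions generated from the smooth ones by the operations of the proof.
    As the partial derivatives of a generated function are generated again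
    (the next lemma), smoothness to all orders needs one induction on
    this predicate, instead of a Leibniz or chain rule of every order.
    The last constructor makes [D] the only place where [f] is looked at. *)
Inductive elementary D : ('rV[R]_d -> R) -> Prop :=
| elem_smooth f of smooth_on D f : elementary D f
| elem_cst c : elementary D (cst c)
| elem_coord j : elementary D (fun x => x ord0 j)
| elemD f g of elementary D f & elementary D g : elementary D (f \+ g)
| elemM f g of elementary D f & elementary D g : elementary D (f \* g)
| elemV f of elementary D f & (forall x, D x -> f x != 0) :
    elementary D (fun x => (f x)^-1)
| elem_exp f of elementary D f : elementary D (expR \o f)
| elem_ln f of elementary D f & (forall x, D x -> 0 < f x) :
    elementary D (@ln R \o f)
| elem_cos f of elementary D f : elementary D (cos \o f)
| elem_sin f of elementary D f : elementary D (sin \o f)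
| elem_flat p f of elementary D f : elementary D (flat p \o f)
| elem_eq f g of elementary D f & (forall x, D x -> f x = g x) : elementary D g.

Lemma elem_differentiable_partial D f : open D -> elementary D f ->
  (forall x, D x -> differentiable f x) /\ forall i, elementary D (partial i f).
Proof.
move=> oD.
elim=> {f}.
- move=> f sf; split; first exact: (sf [::]).
  by move=> i; apply: elem_smooth => s x Dx; have := sf (rcons s i) x Dx;
    rewrite foldr_rcons.
- move=> c; split; first by move=> x _; exact: differentiable_cst.
  move=> i; apply: elem_eq (elem_cst D 0) _ => x _.
  by rewrite /partial derive_cst.
- move=> j; split; first by move=> x _; exact: differentiable_coord.
  move=> i; apply: elem_eq (elem_cst D (i == j)%:R) _ => x _.
  by rewrite partial_coord.
- move=> f g ef [df pf] eg [dg pg]; split.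
    by move=> x Dx; apply: differentiableD; [exact: df|exact: dg].
  move=> i; apply: elem_eq (elemD (pf i) (pg i)) _ => x Dx /=.
  by rewrite partialD//; [exact: df|exact: dg].
- move=> f g ef [df pf] eg [dg pg]; split.
    by move=> x Dx; apply: differentiableM; [exact: df|exact: dg].
  move=> i; apply: elem_eq (elemD (elemM ef (pg i)) (elemM eg (pf i))) _.
  by move=> x Dx /=; rewrite partialM//; [exact: df|exact: dg].
- move=> f ef [df pf] f0; split.
    move=> x Dx; apply: differentiableV; [exact: df|exact: f0].
  move=> i; have eV := elemV ef f0.
  apply: elem_eq (elemM (elemM (elem_cst D (-1)) (elemM eV eV)) (pf i)) _.
  move=> x Dx /=; rewrite [RHS](partial_comp (dg := - f x ^- 2) (g := fun t => t^-1)).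
  - by rewrite mulN1r expr2 invfM.
  - exact: df.
  have -> : - f x ^- 2 = - f x ^- 2 *: (1 : R) by rewrite scaler1.
  by apply: (is_deriveV (f := id)); exact: f0.
- move=> f ef [df pf]; split=> [x Dx|i].
    by apply: differentiable_comp1 (df x Dx) _; exact: (is_derive_expR (f x)).
  apply: elem_eq (elemM (elem_exp ef) (pf i)) _ => x Dx /=.
  by rewrite (partial_comp i (df x Dx) (is_derive_expR (f x))).
- move=> f ef [df pf] f0; split=> [x Dx|i].
    by apply: differentiable_comp1 (df x Dx) _; exact: (is_derive1_ln (f0 x Dx)).
  have fn0 x : D x -> f x != 0 by move=> /f0; rewrite lt0r => /andP[].
  apply: elem_eq (elemM (elemV ef fn0) (pf i)) _ => x Dx /=.
  by rewrite (partial_comp i (df x Dx) (is_derive1_ln (f0 x Dx))).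
- move=> f ef [df pf]; split=> [x Dx|i].
    by apply: differentiable_comp1 (df x Dx) _; exact: (is_derive_cos (f x)).
  apply: elem_eq (elemM (elemM (elem_cst D (-1)) (elem_sin ef)) (pf i)) _ => x Dx /=.
  by rewrite (partial_comp i (df x Dx) (is_derive_cos (f x))) mulN1r.
- move=> f ef [df pf]; split=> [x Dx|i].
    by apply: differentiable_comp1 (df x Dx) _; exact: (is_derive_sin (f x)).
  apply: elem_eq (elemM (elem_cos ef) (pf i)) _ => x Dx /=.
  by rewrite (partial_comp i (df x Dx) (is_derive_sin (f x))).
- move=> p f ef [df pf]; split=> [x Dx|i].
    by apply: differentiable_comp1 (df x Dx) _; exact: (is_derive_flat p (f x)).
  apply: elem_eq (elemM (elem_flat _ ef) (pf i)) _ => x Dx /=.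
  by rewrite (partial_comp i (df x Dx) (is_derive_flat p (f x))).
- move=> f g ef [df pf] fg; split=> [x Dx|i].
    by apply: near_eq_differentiable (df x Dx); exact: open_near_eq fg.
  apply: elem_eq (pf i) _ => x Dx; apply: partial_near; exact: open_near_eq fg.
Qed.

Lemma elem_smooth_on D f : open D -> elementary D f -> smooth_on D f.
Proof.
move=> oD ef s.
suff /(elem_differentiable_partial oD)[] :
  elementary D (foldr (@partial R d) f s).
  by [].
elim: s => //= i s es.
by have [_] := elem_differentiable_partial oD es.
Qed.

Lemma elem_differentiable D f x :
  open D -> elementary D f -> D x -> differentiable f x.
Proof. by move=> oD ef; apply: (elem_differentiable_partial oD ef).1. Qed.

Lemma elem_sum D (I : finType) (P : pred I) (f : I -> 'rV[R]_d -> R) :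
  (forall i, P i -> elementary D (f i)) ->
  elementary D (fun x => \sum_(i | P i) f i x).
Proof.
move=> ef; rewrite (_ : (fun x => _) = \sum_(i | P i) f i); last first.
  by apply/funext => x; rewrite fct_sumE.
by elim/big_ind: _ => //; [exact: elem_cst|move=> ? ?; exact: elemD].
Qed.

Lemma elem_prod D (I : finType) (P : pred I) (f : I -> 'rV[R]_d -> R) :
  (forall i, P i -> elementary D (f i)) ->
  elementary D (fun x => \prod_(i | P i) f i x).
Proof.
move=> ef; rewrite (_ : (fun x => _) = \prod_(i | P i) f i); last first.
  by apply/funext => x; rewrite fct_prodE.
by elim/big_ind: _ => //; [exact: elem_cst|move=> ? ?; exact: elemM].
Qed.

End smooth_calculus.

(** * Lebesgue measure and integration along a coordinate *)

Section euclidean_measure.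
Context {R : realType}.

(** Boxes form a basis of neighbourhoods for the norm of row vectors; they also
    generate the sigma-algebra, and their measure is known. *)
Lemma nbhs_boxP d (x : 'rV[R]_d) (A : set 'rV[R]_d) :
  nbhs x A <-> exists2 e : R, 0 < e &
    forall y : 'rV[R]_d, (forall i, `|x ord0 i - y ord0 i| < e) -> A y.
Proof.
split=> [/nbhs_ballP[e e0 eA]|[e e0 eA]].
  exists e => // y xy; apply: eA; split => // i j.
  by rewrite !ord1; exact: xy.
apply/nbhs_ballP; exists e => // y [_ xy]; apply: eA => i.
exact: xy.
Qed.

Lemma measurable_rV_prod d (A : 'I_d -> set (measurableTypeR R)) :
  (forall i, measurable (A i)) ->
  measurable [set x : 'rV[R]_d | forall i, A i (x ord0 i)].
Proof.
move=> mA; rewrite [X in measurable X](_ : _ = \bigcap_(i : 'I_d)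
  ((fun x : 'rV[R]_d => x ord0 i) @^-1` A i)); last first.
  by apply/seteqP; split=> x /= Ax i => [_|]; exact: Ax.
apply: fin_bigcap_measurable => // i _; rewrite -[X in measurable X]setTI.
by apply: (@measurable_coord R d i measurableT); exact: mA.
Qed.

(** An open set is the union of the countably many rational boxes that it
    contains. *)
Lemma open_measurable_rV d (D : set 'rV[R]_d) : open D -> measurable D.
Proof.
move=> oD.
pose B (p : 'rV[rat]_d * nat) : set 'rV[R]_d :=
  [set x | forall i, x ord0 i \in
     `](ratr (p.1 ord0 i) - p.2.+1%:R^-1), (ratr (p.1 ord0 i) + p.2.+1%:R^-1)[].
pose B' p := if `[< B p `<=` D >] then B p else set0.
have -> : D = \bigcup_p B' p.
  apply/seteqP; split=> [x Dx|x [p _]]; last first.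
    by rewrite /B'; case: asboolP => // BD /BD.
  have /nbhs_boxP[e e0 eD] : nbhs x D by exact: open_nbhs_nbhs.
  have [k ke] : exists k : nat, k.+1%:R^-1 < e / 2.
    exists (Num.truncn (e / 2)^-1).
    rewrite invf_plt ?posrE//; last by rewrite divr_gt0.
    exact: truncnS_gt.
  have hq i : exists q : rat,
      ratr q \in `](x ord0 i - k.+1%:R^-1), (x ord0 i + k.+1%:R^-1)[.
    have [q] := @rat_in_itvoo R (x ord0 i - k.+1%:R^-1) (x ord0 i + k.+1%:R^-1)
      (ltac:(by rewrite ltrD2l gtrN)).
    by exists q.
  have [q hq'] := choice hq.
  exists (\row_i q i, k) => //; rewrite /B'.
  have Bx : B (\row_i q i, k) x.
    move=> i; have := hq' i; rewrite /= mxE !in_itv/= => /andP[h1 h2].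
    by rewrite ltrBlDr h2 /= -ltrBlDr h1.
  case: asboolP => //; case => y By; apply: eD => i.
  have := Bx i; have := By i; rewrite /= !in_itv/=.
  move: (k.+1%:R^-1) ke (ratr _) => a ae r /andP[? ?] /andP[? ?].
  by rewrite ltr_norml; apply/andP; split; lra.
apply: countable_bigcupT_measurable; first exact: countableP.
move=> p; rewrite /B'; case: asboolP => // _.
by apply: (measurable_rV_prod (A := fun i =>
  [set` `](ratr (p.1 ord0 i) - p.2.+1%:R^-1),
          (ratr (p.1 ord0 i) + p.2.+1%:R^-1)[])) => i; exact: measurable_itv.
Qed.

Lemma continuous_measurable_rV d (f : 'rV[R]_d -> R) :
  continuous f -> measurable_fun setT f.
Proof.
move=> cf; apply: (measurability _ (RGenOpens.measurableE R)).
move=> _ [_ [a [b ->] <-]]; rewrite setTI; apply: open_measurable_rV.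
by move/continuousP : cf; apply; exact: interval_open.
Qed.

Definition box d (M : R) : set 'rV[R]_d := [set x | forall i, `|x ord0 i| <= M].

Lemma boxE d M : @box d M = [set x | forall i, `[- M, M]%classic (x ord0 i)].
Proof.
by apply/seteqP; split=> x /= Ax i; have := Ax i; rewrite /= in_itv/= ler_norml.
Qed.

Lemma box_measurable d M : measurable (@box d M).
Proof.
rewrite boxE; apply: (@measurable_rV_prod d (fun=> `[- M, M]%classic)) => i.
exact: measurable_itv.
Qed.

Lemma lebesgue_box_lty d (M : R) : (lebesgue_rV d (@box d M) < +oo)%E.
Proof.
rewrite boxE (@lebesgue_rV_box R d (fun=> `[- M, M]%classic))// ltey_eq.
apply/orP; left; apply: (big_ind (fun x => x \is a fin_num)) => //.
  by move=> x y; exact: fin_numM.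
move=> i _; rewrite ge0_fin_numE// lebesgue_measure_itv/=.
by case: ifP => // _; rewrite -EFinB ltry.
Qed.

Lemma compact_box d (M : R) : compact (@box d M).
Proof.
rewrite boxE; apply: (@rV_compact _ d (fun=> `[- M, M]%classic)) => i.
exact: segment_compact.
Qed.

Lemma integrable_boxed d (f : 'rV[R]_d -> R) M : continuous f ->
  (forall x, ~ box M x -> f x = 0) ->
  (lebesgue_rV d).-integrable setT (EFin \o f).
Proof.
move=> cf f0.
have mf := continuous_measurable_rV cf.
have mB := @box_measurable d M.
have iB : (lebesgue_rV d).-integrable (box M) (EFin \o f).
  apply: measurable_bounded_integrable => //.
  - exact: lebesgue_box_lty.
  - exact: measurable_funTS.
  have /compact_bounded[N [Nr NB]] : compact (f @` box M).
    apply: continuous_compact; last exact: compact_box.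
    exact: continuous_subspaceT.
  exists N; split => // e /NB h x Bx; apply: h; by exists x.
rewrite (_ : EFin \o f = (EFin \o f) \_ (box M)); last first.
  apply/funext => x; rewrite patchE; case: ifPn => //.
  by rewrite notin_setE => /f0 /= ->.
by move/integrable_mkcond : iB; apply.
Qed.

(** The complement of a box is open, so [f] vanishes near each of its points. *)
Lemma partial_boxed d (f : 'rV[R]_d -> R) M i :
  (forall x, ~ box M x -> f x = 0) -> forall x, ~ box M x -> partial i f x = 0.
Proof.
move=> f0 x /existsNP[j /negP]; rewrite -ltNge => jM.
rewrite (@partial_near _ _ _ (cst 0)) ?/partial ?derive_cst//.
apply/nbhs_boxP; exists (`|x ord0 j| - M); first by rewrite subr_gt0.
move=> y xy; apply: f0 => /(_ j); apply/negP; rewrite -ltNge.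
have := xy j.
have := ler_normD (x ord0 j - y ord0 j) (y ord0 j); rewrite subrK.
lra.
Qed.

Lemma continuous_rV_cons d (t : R) (y : 'rV[R]_d) :
  continuous (fun z : 'rV[R]_d => rV_cons (t, z)) /\
  continuous (fun s : R => rV_cons (s, y)).
Proof.
split=> z A /nbhs_boxP[e e0 eA].
  apply/nbhs_boxP; exists e => // w zw; apply: eA => i.
  case: (unliftP ord0 i) => [j|] ->; first by rewrite !rV_consES; exact: zw.
  by rewrite !rV_consE0 subrr normr0.
apply/nbhs_ballP; exists e => // w zw; apply: eA => i.
case: (unliftP ord0 i) => [j|] ->; last by rewrite !rV_consE0.
by rewrite !rV_consES subrr normr0.
Qed.

(** Both difference quotients are the same function of the increment. *)
Lemma derive_rV_consS d (h : 'rV[R]_d.+1 -> R) t y (j : 'I_d) :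
  (derivable h (rV_cons (t, y)) (delta_mx ord0 (lift ord0 j)) ->
  derivable (fun z => h (rV_cons (t, z))) y (delta_mx ord0 j)) /\
  partial j (fun z => h (rV_cons (t, z))) y =
    partial (lift ord0 j) h (rV_cons (t, y)).
Proof.
have E (s : R) : s *: delta_mx ord0 (lift ord0 j) + rV_cons (t, y) =
    rV_cons (t, s *: delta_mx ord0 j + y).
  apply/rowP => k; case: (unliftP ord0 k) => [l|] ->.
    by rewrite rV_consES !mxE eqxx /= liftK (inj_eq lift_inj).
  by rewrite rV_consE0 !mxE unlift_none /= mulr0 add0r.
rewrite /partial /derivable /derive.
rewrite (_ : (fun s : R => s^-1 *: ((h \o shift (rV_cons (t, y)))
   (s *: delta_mx ord0 (lift ord0 j)) - h (rV_cons (t, y)))) =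
 (fun s => s^-1 *: (((fun z => h (rV_cons (t, z))) \o shift y) (s *: delta_mx ord0 j) -
     h (rV_cons (t, y)))))//.
by apply/funext => s /=; rewrite E.
Qed.

Lemma derive_rV_cons0 d (h : 'rV[R]_d.+1 -> R) (t : R) y :
  (derivable h (rV_cons (t, y)) (delta_mx ord0 ord0) ->
  derivable (fun s => h (rV_cons (s, y))) t 1) /\
  'D_1 (fun s => h (rV_cons (s, y))) t = partial ord0 h (rV_cons (t, y)).
Proof.
have E (s : R) : s *: delta_mx ord0 ord0 + rV_cons (t, y) =
    rV_cons (s *: (1 : R) + t, y).
  apply/rowP => k; case: (unliftP ord0 k) => [l|] ->.
    rewrite rV_consES !mxE liftK eqxx /=.
    by rewrite mulr0 add0r.
  by rewrite rV_consE0 !mxE unlift_none eqxx /=.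
rewrite /partial /derivable /derive.
rewrite (_ : (fun s : R => s^-1 *: ((h \o shift (rV_cons (t, y)))
   (s *: delta_mx ord0 ord0) - h (rV_cons (t, y)))) =
 (fun s : R => s^-1 *: (((fun z => h (rV_cons (z, y))) \o shift t) (s *: (1:R)) -
     h (rV_cons (t, y)))))//.
by apply/funext => s /=; rewrite E.
Qed.

Lemma integral_derive1_boxed (F f : R -> R) (M : R) :
  (forall t : R, derivable F t 1) -> (forall t : R, 'D_1 F t = f t) ->
  continuous f -> (forall t : R, M < `|t| -> F t = 0) ->
  (\int[lebesgue_measure]_t (f t)%:E = 0)%E.
Proof.
move=> dF Ff cf F0.
pose N : R := `|M| + 1.
have N0 : - N < N by rewrite gtrN// ltr_wpDl//.
have MN : M < N by rewrite /N; have := ler_norm M; lra.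
have f0 (t : R) : t \notin `[- N, N]%classic -> f t = 0.
  rewrite notin_setE/= in_itv/= -ler_norml => /negP; rewrite -ltNge => Nt.
  rewrite -Ff (@near_eq_derive _ _ _ _ (cst 0)) ?derive_cst//.
  have : \forall s \near t, N < `|s|.
    apply/nbhs_ballP; exists (`|t| - N); first by rewrite /= subr_gt0.
    move=> s; rewrite /ball/= => ts.
    by have := ler_normD (t - s) s; rewrite subrK; lra.
  by apply: filterS => s Ns; rewrite F0// (lt_trans MN).
transitivity (\int[lebesgue_measure]_(t in `[(- N)%R, N]) (f t)%:E)%E.
  rewrite [RHS]integral_mkcond; apply: eq_integral => t _; rewrite patchE.
  by case: ifPn => // /f0 ->.
rewrite (@continuous_FTC2 _ f F)//.
- have N1 : M < `|N| by rewrite ger0_norm// addr_ge0.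
  by rewrite (F0 N)// (F0 (- N)) ?normrN// subee.
- by apply: continuous_subspaceT.
- have cF : continuous F.
    by move=> t; apply/differentiable_continuous/derivable1_diffP.
  split; first by move=> t _.
    by apply: cvg_at_right_filter; exact: cF.
  by apply: cvg_at_left_filter; exact: cF.
- by move=> t _; rewrite derive1E.
Qed.

(** By Fubini the integration along the direction of the derivative can be done
    first, where the fundamental theorem of calculus applies. *)
Lemma integral_partial_boxed d (h : 'rV[R]_d -> R) (i : 'I_d) M :
  (forall x, derivable h x (delta_mx ord0 i)) -> continuous (partial i h) ->
  (forall x, ~ box M x -> h x = 0) ->
  (\int[lebesgue_rV d]_x (partial i h x)%:E = 0)%E.
Proof.
elim: d h i => [h []//|d IH h i dh cph h0].
have mp := continuous_measurable_rV cph.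
have mpe : measurable_fun setT (EFin \o partial i h) by exact/measurable_EFinP.
have ip := integrable_boxed cph (partial_boxed i h0).
have mc := @measurable_rV_cons R d.
have ipc : (lebesgue_measure \x lebesgue_rV d)%E.-integrable setT
    ((EFin \o partial i h) \o @rV_cons R d).
  apply/integrableP; split; first exact: measurableT_comp.
  have /integrableP[_] := ip.
  rewrite /= /lebesgue_rV_step ge0_integral_pushforward//.
  by apply/measurable_EFinP; exact: measurableT_comp.
rewrite /= /lebesgue_rV_step integral_pushforward//.
case: (unliftP ord0 i) => [j|] ij.
- rewrite -integral12_prod_meas1//.
  apply: integral0_eq => t _; rewrite /fubini_F/=.
  transitivity (\int[lebesgue_rV d]_y
      (partial j (fun z => h (rV_cons (t, z))) y)%:E)%E.
    by apply: eq_integral => y _; rewrite (derive_rV_consS h t y j).2 ij.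
  apply: IH.
  + by move=> y; apply: (derive_rV_consS h t y j).1; rewrite -ij.
  + rewrite (_ : partial j _ = partial i h \o (fun z => rV_cons (t, z))).
      move=> y; apply: continuous_comp; last exact: cph.
      exact: (continuous_rV_cons t y).1.
    by apply/funext => y; rewrite (derive_rV_consS h t y j).2 ij.
  + move=> y /existsNP[k hk]; apply: h0; apply/existsNP; exists (lift ord0 k).
    by rewrite rV_consES.
- rewrite -integral21_prod_meas1//.
  apply: integral0_eq => y _; rewrite /fubini_G/=.
  apply: (@integral_derive1_boxed (fun t => h (rV_cons (t, y))) _ M).
  + by move=> t; apply: (derive_rV_cons0 h t y).1; rewrite -ij.
  + by move=> t; rewrite (derive_rV_cons0 h t y).2 ij.
  + move=> t; apply: (continuous_comp (f := fun t => rV_cons (t, y))); last exact: cph.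
    exact: (continuous_rV_cons t y).2.
  + move=> t Mt; apply: h0; apply/existsNP; exists ord0.
    by rewrite rV_consE0 /=; apply/negP; rewrite -ltNge.
Qed.

End euclidean_measure.

(** * Compactly supported smooth functions and the divergence theorem *)

Section compact_support.
Context {R : realType} {d : nat}.
Implicit Types (f g : 'rV[R]_d -> R) (D K : set 'rV[R]_d).

Lemma foldr_partial_eq D f g s : open D -> (forall x, D x -> f x = g x) ->
  forall x, D x -> foldr (@partial R d) f s x = foldr (@partial R d) g s x.
Proof.
move=> oD fg; elim: s => //= i s IH x Dx; apply: partial_near.
exact: open_near_eq IH.
Qed.

Lemma smooth_on_eq D f g : open D -> (forall x, D x -> f x = g x) ->
  smooth_on D f -> smooth_on D g.
Proof.
move=> oD fg sf s x Dx; apply: near_eq_differentiable (sf s x Dx).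
by apply: (open_near_eq oD Dx) => y Dy; exact: (foldr_partial_eq s oD fg).
Qed.

Lemma smooth_onS D D' f : D `<=` D' -> smooth_on D' f -> smooth_on D f.
Proof. by move=> DD' sf s x /DD'; exact: sf. Qed.

Lemma smooth_on_partial D f i : smooth_on D f -> smooth_on D (partial i f).
Proof. by move=> sf s x Dx; have := sf (rcons s i) x Dx; rewrite foldr_rcons. Qed.

Lemma smooth_on_continuous f : smooth_on setT f -> continuous f.
Proof.
by move=> sf x; apply: differentiable_continuous; exact: (sf [::]).
Qed.

Definition zero_ext D f x := if x \in D then f x else 0.

Lemma zero_extE D f x : D x -> zero_ext D f x = f x.
Proof. by move=> Dx; rewrite /zero_ext mem_set. Qed.

(** Only the values on [D] count: [f] may be the product of a test function by
    a field that is singular on the boundary of [D]. *)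
Definition csupp_smooth D f := smooth_on D f /\
  exists K, [/\ compact K, K `<=` D & forall x, D x -> ~ K x -> f x = 0].

Lemma compact_openC K : compact K -> open (~` K).
Proof.
by move=> cK; apply: closed_openC; apply: compact_closed cK; exact: norm_hausdorff.
Qed.

(** The space is covered by [D] and by the complement of the compact support,
    which is open; the extension is smooth on each of them. *)
Lemma zero_ext_smooth D f : open D -> csupp_smooth D f ->
  smooth_on setT (zero_ext D f).
Proof.
move=> oD [sf [K [cK KD f0]]] s x _.
have [Dx|nDx] := pselect (D x).
  apply: (@smooth_on_eq D f) => //.
  by move=> y Dy; rewrite zero_extE.
have oK := compact_openC cK.
apply: (@smooth_on_eq (~` K) (cst 0)) => //; last by move=> /KD.
  move=> y Ky; rewrite /zero_ext; case: ifPn => //; rewrite inE => Dy.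
  by rewrite f0.
by apply: elem_smooth_on => //; exact: elem_cst.
Qed.

Lemma zero_ext_boxed D f : csupp_smooth D f -> exists M : R,
  forall x, ~ box M x -> zero_ext D f x = 0.
Proof.
move=> [_ [K [/compact_bounded[N [_ NK]] KD f0]]].
exists (N + 1) => x nB; rewrite /zero_ext; case: ifPn => //; rewrite inE => Dx.
apply: f0 => // Kx; apply: nB => i.
have := NK (N + 1) (ltr_pwDr ltr01 (lexx N)) x Kx; apply: le_trans.
rewrite [leRHS]/Num.norm /= mx_normrE; apply/bigmax_geP; right => /=.
by exists (ord0, i).
Qed.

Lemma csupp_integrable D f : open D -> csupp_smooth D f ->
  (lebesgue_rV d).-integrable D (EFin \o f).
Proof.
move=> oD sf; have [M f0] := zero_ext_boxed sf.
have := integrable_boxed (smooth_on_continuous (zero_ext_smooth oD sf)) f0.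
have mD := open_measurable_rV oD.
move=> /(integrableS measurableT mD (@subsetT _ D)).
apply: eq_integrable => // x; rewrite inE => Dx /=.
by rewrite zero_extE.
Qed.

Lemma csupp_partial D f i : open D -> csupp_smooth D f ->
  csupp_smooth D (partial i f).
Proof.
move=> oD [sf [K [cK KD f0]]]; split; first exact: smooth_on_partial.
exists K; split => // x Dx Kx.
rewrite (@partial_near _ _ _ (cst 0)) ?/partial ?derive_cst//.
have : nbhs x (D `&` ~` K).
  apply: open_nbhs_nbhs; split => //; apply: openI => //.
  exact: compact_openC.
by apply: filterS => y [Dy Ky]; rewrite f0.
Qed.

Lemma partial_zero_ext D f i x : open D -> csupp_smooth D f ->
  partial i (zero_ext D f) x = zero_ext D (partial i f) x.
Proof.
move=> oD [_ [K [cK KD k0]]].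
have [Dx|nDx] := pselect (D x).
  rewrite zero_extE//; apply: partial_near; apply: (open_near_eq oD Dx) => y Dy.
  by rewrite zero_extE.
rewrite [RHS]/zero_ext memNset//.
rewrite (@partial_near _ _ _ (cst 0)) ?/partial ?derive_cst//.
have : nbhs x (~` K).
  by apply: open_nbhs_nbhs; split; [exact: compact_openC|move=> /KD].
apply: filterS => y Ky; rewrite /zero_ext; case: ifPn => //; rewrite inE => Dy.
by rewrite k0.
Qed.

Lemma integral_zero_ext D (E : set 'rV[R]_d) f : D `<=` E ->
  (\int[lebesgue_rV d]_(x in E) (zero_ext D f x)%:E =
   \int[lebesgue_rV d]_(x in D) (f x)%:E)%E.
Proof.
move=> DE; rewrite [LHS]integral_mkcond [RHS]integral_mkcond.
apply: eq_integral => x _; rewrite !patchE /zero_ext.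
case: (boolP (x \in D)) => xD; last by case: ifP.
by rewrite mem_set//; apply: DE; rewrite inE in xD.
Qed.

Lemma integral_partial_csupp D f i : open D -> csupp_smooth D f ->
  (\int[lebesgue_rV d]_(x in D) (partial i f x)%:E = 0)%E.
Proof.
move=> oD sf; have [M f0] := zero_ext_boxed sf.
have sz := zero_ext_smooth oD sf.
rewrite -[RHS](@integral_partial_boxed R d (zero_ext D f) i M)//; last 2 first.
- by move=> x; apply: diff_derivable; exact: (sz [::]).
- exact/smooth_on_continuous/smooth_on_partial.
rewrite -(integral_zero_ext _ (@subsetT _ D)).
by apply: eq_integral => x _; rewrite partial_zero_ext.
Qed.

Lemma csuppD D f g : open D -> csupp_smooth D f -> csupp_smooth D g ->
  csupp_smooth D (f \+ g).
Proof.
move=> oD [sf [K [cK KD f0]]] [sg [L [cL LD g0]]]; split.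
  by apply: elem_smooth_on => //; apply: elemD; exact: elem_smooth.
exists (K `|` L); split; first exact: compactU.
  by move=> x [/KD|/LD].
by move=> x Dx /not_orP[Kx Lx] /=; rewrite f0// g0// addr0.
Qed.

Lemma csuppM D f g : open D -> csupp_smooth D f -> elementary D g ->
  csupp_smooth D (f \* g).
Proof.
move=> oD [sf [K [cK KD f0]]] eg; split.
  by apply: elem_smooth_on => //; apply: elemM => //; exact: elem_smooth.
by exists K; split => // x Dx Kx /=; rewrite f0// mul0r.
Qed.

Lemma csupp0 D : csupp_smooth D (cst 0).
Proof.
split; last by exists set0; split => //; exact: compact0.
apply: (@smooth_onS D setT) => //.
by apply: elem_smooth_on; [exact: openT|exact: elem_cst].
Qed.

Lemma csupp_sum D (h : 'I_d -> 'rV[R]_d -> R) : open D ->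
  (forall i, csupp_smooth D (h i)) ->
  csupp_smooth D (fun x => \sum_i h i x).
Proof.
move=> oD sh.
rewrite (_ : (fun x => _) = \sum_i h i); last first.
  by apply/funext => x; rewrite fct_sumE.
elim/big_ind: _ => //; first exact: csupp0.
by move=> f g; exact: csuppD.
Qed.

Lemma divergence_theorem_csupp D (h : 'I_d -> 'rV[R]_d -> R) : open D ->
  (forall i, csupp_smooth D (h i)) ->
  (\int[lebesgue_rV d]_(x in D) (\sum_i partial i (h i) x)%:E = 0)%E.
Proof.
move=> oD sh.
under eq_integral do rewrite -sumEFin.
rewrite integral_sum//.
- by rewrite big1// => i _; exact: integral_partial_csupp.
- exact: open_measurable_rV.
- by move=> i; apply: csupp_integrable => //; exact: csupp_partial.
Qed.

End compact_support.

(** * Logarithmic gradients on the Weyl chamber *)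

Section weyl_field.
Context {R : realType} {d : nat}.
Implicit Types (x : 'rV[R]_d) (D : set 'rV[R]_d).

Definition sqnorm x : R := \sum_i x ord0 i ^+ 2.

(** As [0^-1 = 0], the diagonal terms of the sums below vanish. *)
Definition inv_gap x (i j : 'I_d) : R := (x ord0 i - x ord0 j)^-1.

Definition gap_sum (i : 'I_d) x : R := \sum_(j | j != i) inv_gap x i j.

Lemma gap_sumE i x : gap_sum i x = \sum_j inv_gap x i j.
Proof.
rewrite [RHS](bigD1 i)//= /inv_gap subrr invr0 add0r.
by apply: eq_bigl => j.
Qed.

(** Euler's relation for the Vandermonde product, whose degree is
    [d (d - 1) / 2]. For distinct [i] and [j], the
    terms [(i, j)] and [(j, i)] add up to 1. *)
Lemma sum_mul_gap_sum x : (forall i j, i != j -> x ord0 i != x ord0 j) ->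
  2 * \sum_i x ord0 i * gap_sum i x = d%:R ^+ 2 - d%:R.
Proof.
move=> inj.
have -> : \sum_i x ord0 i * gap_sum i x = \sum_i \sum_j x ord0 i * inv_gap x i j.
  by apply: eq_bigr => i _; rewrite gap_sumE mulr_sumr.
rewrite mulr_natl mulr2n {2}exchange_big -big_split/=.
have E i : \sum_j x ord0 i * inv_gap x i j + \sum_j x ord0 j * inv_gap x j i =
    \sum_j (1 - (j == i)%:R).
  rewrite -big_split/=; apply: eq_bigr => j _; rewrite /inv_gap.
  have [->|ji] := eqVneq j i; first by rewrite !subrr invr0 !mulr0 addr0.
  rewrite subr0; have := inj _ _ ji => xji.
  by field; rewrite !subr_eq0 xji eq_sym xji.
under eq_bigr do rewrite E big_split/= sumr_const card_ord sumrN.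
rewrite big_split/= sumrN sumr_const card_ord -mulrnA expr2 -natrM.
congr (_ - _).
transitivity (\sum_(i < d) (1 : R)); last by rewrite sumr_const card_ord.
apply: eq_bigr => i _.
by rewrite (bigD1 i)//= eqxx big1 ?addr0// => j /negPf ->.
Qed.

(** The sum over triples of distinct indices vanishes, because the three
    cyclic rotations of a triple contribute
    [1/((a-b)(a-c)) + 1/((b-c)(b-a)) + 1/((c-a)(c-b)) = 0].
    This is the harmonicity of the Vandermonde product. *)
Lemma sum_sqr_gap_sum x : (forall i j, i != j -> x ord0 i != x ord0 j) ->
  \sum_i gap_sum i x ^+ 2 = \sum_i \sum_j inv_gap x i j ^+ 2.
Proof.
move=> inj; apply/eqP; rewrite -subr_eq0 -sumrB; apply/eqP.
pose T i j k := inv_gap x i j * inv_gap x i k - (j == k)%:R * inv_gap x i j ^+ 2.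
transitivity (\sum_i \sum_j \sum_k T i j k).
  apply: eq_bigr => i _; rewrite gap_sumE expr2 mulr_suml -sumrB.
  apply: eq_bigr => j _; rewrite mulr_sumr sumrB; congr (_ - _).
  rewrite (bigD1 j)//= eqxx mul1r big1 ?addr0// => k kj.
  by rewrite eq_sym (negPf kj) mul0r.
have rot (G : 'I_d -> 'I_d -> 'I_d -> R) :
    \sum_i \sum_j \sum_k G i j k = \sum_i \sum_j \sum_k G j k i.
  under eq_bigr do rewrite exchange_big.
  by rewrite exchange_big.
have cyc i j k : T i j k + T j k i + T k i j = 0.
  rewrite /T /inv_gap.
  have [ij|ij] := eqVneq i j; have [ki|ki] := eqVneq k i;
    rewrite -?ij ?ki ?eqxx ?subrr ?invr0 /=.
  - by ring.
  - by ring.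
  - by rewrite ij [j == i]eq_sym (negPf ij) /=; ring.
  have [<-|jk] := eqVneq j k.
    by rewrite subrr invr0 mulr0 !mul0r mul1r expr2; ring.
  have := inj _ _ ij; have := inj _ _ ki; have := inj _ _ jk.
  move=> h1 h2 h3; rewrite /= !mul0r !subr0. field.
  rewrite !subr_eq0 (eq_sym (x ord0 k) (x ord0 j)).
  by rewrite (eq_sym (x ord0 j) (x ord0 i)) (eq_sym (x ord0 i) (x ord0 k)) h1 h2 h3.
suff : 3 * \sum_i \sum_j \sum_k T i j k = 0.
  by move/eqP; rewrite mulf_eq0 pnatr_eq0 => /eqP.
have -> (a : R) : 3 * a = a + a + a by ring.
have S1 := rot T; have S2 := rot (fun i j k => T j k i).
rewrite {2}S1 {2}S1 {2}S2 -!big_split/=.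
rewrite big1// => i _; rewrite -!big_split/= big1// => j _.
by rewrite -!big_split/= big1// => k _; exact: cyc.
Qed.

(** The gradient of the logarithm of a Vandermonde product times a radial
    function: the gap sum comes from the product, and [m x_i] from the radial
    factor. *)
Definition weyl_field (m : 'rV[R]_d -> R) (i : 'I_d) x : R :=
  gap_sum i x + m x * x ord0 i.

Lemma open_weyl : open (weyl_chamber R d).
Proof.
rewrite openE => x xW; apply/nbhs_boxP.
pose g (p : 'I_d * 'I_d) : R :=
  if (p.1 < p.2)%N then x ord0 p.2 - x ord0 p.1 else 1.
have g0 p : 0 < g p.
  by rewrite /g; case: ifP => // /xW; rewrite subr_gt0.
(* Moving each coordinate by less than half the smallest gap keeps the order. *)
exists ((\big[Num.min/1]_p g p) / 2).
  by rewrite divr_gt0//; apply/bigmin_gtP; split.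
move=> y xy i j ij.
have : \big[Num.min/1]_p g p <= g (i, j) by exact: bigmin_le_cond.
rewrite /g/= ij; have := xy i; have := xy j.
rewrite !ltr_norml => /andP[h1 h2] /andP[h3 h4] h5.
move: (\big[_/_]_p _) h1 h2 h3 h4 h5 => e *; lra.
Qed.

Lemma weyl_inj x : weyl_chamber R d x ->
  forall i j : 'I_d, i != j -> x ord0 i != x ord0 j.
Proof.
move=> xW i j ij; have [h|h|/val_inj h] := ltngtP i j.
- by rewrite lt_eqF// xW.
- by rewrite gt_eqF// xW.
- by rewrite h eqxx in ij.
Qed.

Lemma sqnorm_gt0 x : (1 < d)%N -> weyl_chamber R d x -> 0 < sqnorm x.
Proof.
move=> d1 xW.
have d0 : (0 < d)%N by exact: ltnW.
have := weyl_inj xW (isT : Ordinal d0 != Ordinal d1).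
move=> x01; rewrite lt_neqAle sumr_ge0 ?andbT; last by move=> *; exact: sqr_ge0.
apply: contra_neq x01 => /esym/psumr_eq0P h.
have {}h i : x ord0 i = 0.
  by apply/eqP; rewrite -sqrf_eq0; apply/eqP/h => // j _; exact: sqr_ge0.
by rewrite !h.
Qed.

Lemma elem_sqnorm D : elementary D sqnorm.
Proof.
apply: elem_sum => i _.
rewrite (_ : (fun x => _) = (fun x => x ord0 i) \* (fun x => x ord0 i)).
  by apply: elemM; exact: elem_coord.
by apply/funext => x /=; rewrite expr2.
Qed.

Lemma elem_diff_coord D i j : elementary D (fun x => x ord0 i - x ord0 j).
Proof.
apply: (@elem_eq _ _ _ ((fun x => x ord0 i) \+ (cst (-1) \* (fun x => x ord0 j)))).
  by apply: elemD; [|apply: elemM]; do ?[exact: elem_coord|exact: elem_cst].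
by move=> x _ /=; rewrite mulN1r.
Qed.

Lemma elem_weyl_field D m i : D `<=` weyl_chamber R d -> elementary D m ->
  elementary D (weyl_field m i).
Proof.
move=> DW em; apply: elemD; last by apply: elemM => //; exact: elem_coord.
apply: elem_sum => j ji; apply: elemV; first exact: elem_diff_coord.
move=> x /DW xW; rewrite subr_eq0 eq_sym; exact: weyl_inj.
Qed.

Lemma partial_sqnorm i x : partial i sqnorm x = 2 * x ord0 i.
Proof.
have dx j (y : 'rV[R]_d) : differentiable (fun x : 'rV[R]_d => x ord0 j) y.
  exact: differentiable_coord.
rewrite /sqnorm (partial_sum i _).2; last first.
  by move=> j _; under eq_fun do rewrite expr2; exact: differentiableM.
rewrite (bigD1 i)//= big1 ?addr0.
  under eq_fun do rewrite expr2.
  by rewrite partialM// partial_coord eqxx /=; ring.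
move=> j ji; under eq_fun do rewrite expr2.
by rewrite partialM// partial_coord eq_sym (negPf ji) /=; ring.
Qed.

Lemma differentiable_sqnorm x : differentiable sqnorm x.
Proof. exact: elem_differentiable openT (elem_sqnorm setT) I. Qed.

Lemma partial_diff_coord (i j k : 'I_d) x :
  partial k (fun y : 'rV[R]_d => y ord0 i - y ord0 j) x =
    (k == i)%:R - (k == j)%:R.
Proof.
have dx j' : differentiable (fun x : 'rV[R]_d => x ord0 j') x.
  exact: differentiable_coord.
rewrite /partial deriveB; [|exact: diff_derivable..].
by congr (_ - _); exact: partial_coord.
Qed.

Lemma partial_weyl_field m m1 i x : weyl_chamber R d x ->
  differentiable m x -> partial i m x = m1 * x ord0 i ->
  partial i (weyl_field m i) x =
    - (\sum_j inv_gap x i j ^+ 2) + m x + m1 * x ord0 i ^+ 2.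
Proof.
move=> xW dm pm.
have dg j : j != i -> differentiable (fun y : 'rV[R]_d => y ord0 i - y ord0 j) x.
  by move=> _; apply: differentiableB; exact: differentiable_coord.
have g0 j : j != i -> x ord0 i - x ord0 j != 0.
  by move=> ji; rewrite subr_eq0 eq_sym; exact: weyl_inj.
have [ds ps] : differentiable (gap_sum i) x /\
    partial i (gap_sum i) x = - \sum_j inv_gap x i j ^+ 2.
  have [] := @partial_sum R d _ (fun j => j != i) (fun j y => inv_gap y i j) i x.
    by move=> j ji; apply: differentiableV; [exact: dg|exact: g0].
  move=> ds ps; split => //; rewrite [LHS]ps [in RHS](bigD1 i)//=.
  rewrite /inv_gap subrr invr0 expr0n/= add0r -sumrN; apply: eq_bigr => j ji.
  rewrite /partial deriveV; [|exact: g0|exact/diff_derivable/dg].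
  rewrite -/(partial _ _ _) partial_diff_coord eqxx eq_sym (negPf ji) subr0.
  by rewrite /GRing.scale/= mulr1 exprVn.
rewrite /weyl_field partialD//; last first.
  by apply: differentiableM => //; exact: differentiable_coord.
rewrite ps partialM//; last exact: differentiable_coord.
by rewrite partial_coord eqxx pm /=; ring.
Qed.

(** [div F + |F|^2] is radial when [m] is: the singular terms cancel by
    [sum_sqr_gap_sum] and the mixed ones add up to a multiple of [m] by
    [sum_mul_gap_sum]. *)
Lemma riccati_weyl_field m m1 x : weyl_chamber R d x ->
  differentiable m x -> (forall i, partial i m x = m1 * x ord0 i) ->
  \sum_i (partial i (weyl_field m i) x + weyl_field m i x ^+ 2) =
  d%:R ^+ 2 * m x + sqnorm x * (m1 + m x ^+ 2).
Proof.
move=> xW dm pm.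
have inj := weyl_inj xW.
have E i : partial i (weyl_field m i) x + weyl_field m i x ^+ 2 =
   (gap_sum i x ^+ 2 - \sum_j inv_gap x i j ^+ 2) +
   (2 * m x) * (x ord0 i * gap_sum i x) + m x + x ord0 i ^+ 2 * (m1 + m x ^+ 2).
  by rewrite (partial_weyl_field xW dm (pm i)) /weyl_field; ring.
under eq_bigr do rewrite E.
rewrite !big_split/= sumrN sum_sqr_gap_sum// subrr add0r -mulr_sumr.
rewrite -mulr_suml -/(sqnorm x) sumr_const card_ord.
congr (_ + _); rewrite mulrAC sum_mul_gap_sum// -mulr_natl; ring.
Qed.

End weyl_field.

(** * The Hardy inequality *)

Section hardy_inequality.
Context {R : realType} {d : nat}.
Implicit Types (x : 'rV[R]_d) (u : 'rV[R]_d -> R[i]).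
Hypothesis d1 : (1 < d)%N.

Local Notation W := (weyl_chamber R d).
Local Notation ReF u := (fun x => complex.Re (u x)).
Local Notation ImF u := (fun x => complex.Im (u x)).

Lemma enorm_sqr x : enorm x ^+ 2 = sqnorm x.
Proof.
by rewrite /enorm sqr_sqrtr// sumr_ge0// => i _; exact: sqr_ge0.
Qed.

Lemma normc_sqr (z : R[i]) :
  ComplexField.Normc.normc z ^+ 2 = complex.Re z ^+ 2 + complex.Im z ^+ 2.
Proof.
by case: z => a b /=; rewrite sqr_sqrtr// addr_ge0// sqr_ge0.
Qed.

Lemma gradnorm_sqr u x : gradnorm u x ^+ 2 =
  \sum_i (partial i (ReF u) x ^+ 2 + partial i (ImF u) x ^+ 2).
Proof.
rewrite /gradnorm sqr_sqrtr; last by rewrite sumr_ge0// => i _; exact: sqr_ge0.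
by apply: eq_bigr => i _; rewrite normc_sqr.
Qed.

Lemma C0oo_csupp u (D : set 'rV[R]_d) : C0oo D u ->
  csupp_smooth D (ReF u) /\ csupp_smooth D (ImF u).
Proof.
move=> [[sf sg] cK KD].
have u0 x : ~ closure [set x | u x != 0] x -> u x = 0.
  by move=> nx; apply/eqP; apply/negPn/negP => ux; apply: nx; exact: subset_closure.
split; (split; [by move=> s x _; first [exact: sf|exact: sg]|]);
  by eexists; split; [exact: cK|exact: KD|move=> x _ /u0 ->].
Qed.

Lemma elem_sqnormV D : D `<=` W -> elementary D (fun x => (sqnorm x)^-1).
Proof.
move=> DW; apply: elemV; first exact: elem_sqnorm.
by move=> x /DW xW; rewrite gt_eqF// sqnorm_gt0.
Qed.

(** Ground state substitution with [m = - a / |x|^2], that is, with the field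
    [F = grad w / w] of [w = |x|^(-a) V]. *)
Lemma hardy_weyl u : C0oo W u ->
  (((d%:R ^+ 2 - 2) ^+ 2 / 4)%:E * \int[lebesgue_rV d]_(x in W)
              (ComplexField.Normc.normc (u x) ^+ 2 / enorm x ^+ 2)%:E
     <= \int[lebesgue_rV d]_(x in W) (gradnorm u x ^+ 2)%:E)%E.
Proof.
move=> /C0oo_csupp[cf cg].
set f := ReF u in cf; set g := ImF u in cg.
have oW : open W := open_weyl.
have mW := open_measurable_rV oW.
pose a : R := (d%:R ^+ 2 - 2) / 2.
have -> : (d%:R ^+ 2 - 2) ^+ 2 / 4 = a ^+ 2 by rewrite /a; field.
have ef : elementary W f by apply: elem_smooth; exact: cf.1.
have eg : elementary W g by apply: elem_smooth; exact: cg.1.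
pose rho := (f \* f) \+ (g \* g).
have crho : csupp_smooth W rho by apply: csuppD => //; exact: csuppM.
have eq1 := elem_sqnormV (@subset_refl _ W).
pose m := cst (- a) \* (fun x => (sqnorm x)^-1).
have em : elementary W m by apply: elemM => //; exact: elem_cst.
pose F := weyl_field m.
have eF i : elementary W (F i) by exact: elem_weyl_field.
pose h i := rho \* F i.
have ch i : csupp_smooth W (h i) by exact: csuppM.
pose A := rho \* (fun x => (sqnorm x)^-1).
have cA : csupp_smooth W A by exact: csuppM.
pose G x := \sum_i (partial i f \* partial i f \+ partial i g \* partial i g) x.
have cG : csupp_smooth W G.
  apply: csupp_sum => // i; apply: csuppD => //; apply: csuppM => //.
  - exact: csupp_partial.
  - by apply: elem_smooth; apply: smooth_on_partial; exact: cf.1.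
  - exact: csupp_partial.
  - by apply: elem_smooth; apply: smooth_on_partial; exact: cg.1.
rewrite (_ : (\int[_]_(x in W) _)%E =
    \int[lebesgue_rV d]_(x in W) (A x)%:E)%E; last first.
  by apply: eq_integral => x _; rewrite enorm_sqr normc_sqr.
rewrite [leRHS](_ : _ = \int[lebesgue_rV d]_(x in W) (G x)%:E)%E; last first.
  by apply: eq_integral => x _; rewrite gradnorm_sqr.
have iA := csupp_integrable oW cA.
have idiv : (lebesgue_rV d).-integrable W (fun x => (\sum_i partial i (h i) x)%:E).
  apply: (csupp_integrable (f := fun x => \sum_i partial i (h i) x)) => //.
  by apply: csupp_sum => // i; exact: csupp_partial.
have div0 := divergence_theorem_csupp oW ch.
rewrite -integralZl// -[leLHS]adde0 -div0 -integralD//; last exact: integrableZl.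
apply: le_integral => //.
- by apply: integrableD => //; exact: integrableZl.
- exact: csupp_integrable.
move=> x; rewrite inE => xW; rewrite lee_fin.
have q0 : sqnorm x != 0 by rewrite gt_eqF// sqnorm_gt0.
have dw k : elementary W k -> differentiable k x.
  by move=> ek; exact: elem_differentiable ek xW.
have pm i : partial i m x = (2 * a / sqnorm x ^+ 2) * x ord0 i.
  rewrite /m partialM; [|exact/dw/elem_cst|exact: dw].
  rewrite (partialV i (differentiable_sqnorm x) q0).2 partial_sqnorm.
  rewrite /partial derive_cst mulr0 addr0 /cst.
  by field.
have ric : \sum_i (partial i (F i) x + F i x ^+ 2) = _ :=
  riccati_weyl_field xW (dw _ em) pm.
have prho i : partial i rho x = 2 * f x * partial i f x + 2 * g x * partial i g x.
  have df := dw _ ef; have dg := dw _ eg.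
  rewrite /rho partialD; [|exact: differentiableM..].
  by rewrite !partialM//; ring.
have ph i : partial i (h i) x = rho x * partial i (F i) x +
    F i x * (2 * f x * partial i f x + 2 * g x * partial i g x).
  rewrite -prho partialM//; last exact: dw.
  by apply: dw; apply: elem_smooth; exact: crho.1.
rewrite -subr_ge0.
(* Completing the square leaves the Riccati expression, which cancels. *)
have -> : G x - (a ^+ 2 * A x + \sum_i partial i (h i) x) =
   \sum_i ((partial i f x - f x * F i x) ^+ 2 + (partial i g x - g x * F i x) ^+ 2).
  transitivity (\sum_i ((partial i f x - f x * F i x) ^+ 2 +
       (partial i g x - g x * F i x) ^+ 2)
     - (a ^+ 2 * A x + rho x * \sum_i (partial i (F i) x + F i x ^+ 2))).
    rewrite mulr_sumr !opprD ![in RHS]addrA [in RHS]addrAC addrA [in LHS]addrAC.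
    congr (_ - _); rewrite /G -!sumrB; apply: eq_bigr => i _.
    by rewrite ph /rho/=; ring.
  have -> : a ^+ 2 * A x + rho x * \sum_i (partial i (F i) x + F i x ^+ 2) = 0.
    by rewrite ric /A /m /cst/= /a; field.
  by rewrite subr0.
by apply: sumr_ge0 => i _; rewrite addr_ge0// sqr_ge0.
Qed.

End hardy_inequality.

(** * Smooth truncation *)

Section truncation.
Context {R : realType}.
Implicit Types t s e : R.

(** [(s - e) exp (- e / (s - e))] for [s > e], and 0 below: a smooth version of
    the positive part of [s - e]. It is written as a rescaling of
    [t exp (-1/t)]. *)
Definition truncate e s : R := e * ((s / e - 1) * flat 1 (s / e - 1)).

Definition dtruncate e s : R :=
  flat 1 (s / e - 1) + (s / e - 1) * flat 'X^2 (s / e - 1).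

Lemma flat1E t : 0 < t -> flat 1 t = expR (- t^-1).
Proof. by move=> t0; rewrite /flat t0 hornerC mul1r. Qed.

Lemma flat_npos (p : {poly R}) t : t <= 0 -> flat p t = 0.
Proof. by move=> t0; rewrite /flat ltNge t0. Qed.

Lemma is_derive_truncate e s : 0 < e ->
  is_derive s 1 (truncate e) (dtruncate e s).
Proof.
move=> e0.
have dl : is_derive s 1 (fun s : R => s / e - 1) e^-1.
  rewrite (_ : (fun s : R => s / e - 1) = e^-1 *: (id : R -> R) - cst 1); last first.
    by apply/funext => y; rewrite !fctE /cst /GRing.scale/= mulrC.
  by apply: is_derive_eq; rewrite subr0 /GRing.scale/= mulr1.
have df := is_derive_flat 1 (s / e - 1).
have dc := @is_derive1_comp _ (flat 1) (fun s : R => s / e - 1) _ _ _ df dl.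
have dm := is_deriveM dl dc.
have dz := is_deriveZ e dm.
rewrite (_ : truncate e = e *: ((fun s : R => s / e - 1) *
    (flat 1 \o (fun s : R => s / e - 1)))).
  apply: (is_derive_eq dz).
  rewrite derivC subr0 mulr1 /GRing.scale/= /dtruncate; field.
  by rewrite gt_eqF.
by [].
Qed.

(** With [t = s / e - 1 > 0] the derivative is [(1 + 1/t) exp (-1/t)], and
    [1 + y <= exp y]. *)
Lemma dtruncate_bounds e s : 0 <= dtruncate e s <= 1.
Proof.
rewrite /dtruncate; set t := s / e - 1.
have [t0|t0] := ltP 0 t; last by rewrite !flat_npos// mulr0 addr0 lexx ler01.
rewrite flat1E// /flat t0 hornerXn.
have -> : expR (- t^-1) + t * (t^-1 ^+ 2 * expR (- t^-1)) =
    (1 + t^-1) * expR (- t^-1) by field; rewrite gt_eqF.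
have y0 : 0 < t^-1 by rewrite invr_gt0.
apply/andP; split; first by rewrite mulr_ge0 ?expR_ge0// addr_ge0// (ltW y0).
by rewrite expRN ler_pdivrMr ?expR_gt0// mul1r expR_ge1Dx.
Qed.

Lemma truncate0 e s : 0 < e -> s <= e -> truncate e s = 0.
Proof.
by move=> e0 se; rewrite /truncate flat_npos ?mulr0// subr_le0 ler_pdivrMr// mul1r.
Qed.

Lemma truncate_ge0 e s : 0 < e -> 0 <= truncate e s.
Proof.
move=> e0; have [se|es] := leP s e; first by rewrite truncate0.
have t0 : 0 < s / e - 1 by rewrite subr_gt0 ltr_pdivlMr// mul1r.
by rewrite /truncate flat1E// mulr_ge0 ?(ltW e0)// mulr_ge0 ?expR_ge0// (ltW t0).
Qed.

(** Again [1 + y <= exp y], now at [y = - 1/t]. *)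
Lemma truncate_ge e s : 0 < e -> s - 2 * e <= truncate e s.
Proof.
move=> e0; have [se|es] := leP s e; first by rewrite truncate0//; lra.
have t0 : 0 < s / e - 1 by rewrite subr_gt0 ltr_pdivlMr// mul1r.
rewrite /truncate flat1E//; set t := s / e - 1 in t0 *.
have -> : s - 2 * e = e * (t - 1) by rewrite /t; field; rewrite gt_eqF.
rewrite ler_pM2l//.
have -> : t - 1 = t * (1 + - t^-1) by field; rewrite gt_eqF.
by rewrite ler_pM2l// expR_ge1Dx.
Qed.

End truncation.

(** * An oscillating solution of the Euler-Lagrange equation *)

Section oscillating_solution.
Context {R : realType} {d : nat}.
Hypothesis d1 : (1 < d)%N.
Variable k : R.
Hypothesis k0 : 0 < k.
Implicit Types (x : 'rV[R]_d) (D : set 'rV[R]_d).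
Local Notation W := (weyl_chamber R d).

(** The decay rate [a] of the radial factor; its square is the Hardy
    constant. *)
Definition hardy_exponent : R := (d%:R ^+ 2 - 2) / 2.

(** [k log |x|]. *)
Definition angle x : R := k / 2 * ln (sqnorm x).

Definition vandermonde x : R :=
  \prod_(p : 'I_d * 'I_d | (p.1 < p.2)%N) (x ord0 p.2 - x ord0 p.1).

Definition oscillator x : R :=
  vandermonde x * (expR (- (hardy_exponent / 2) * ln (sqnorm x)) * cos (angle x)).

Definition osc_domain : set 'rV[R]_d := W `&` [set x | `|angle x| < pi / 2].

(** The radial part of the logarithmic gradient of [oscillator]:
    [- (a + k tan (k log |x|)) / |x|^2]. *)
Definition osc_radial x : R :=
  - (hardy_exponent + k * (sin (angle x) / cos (angle x))) / sqnorm x.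

Lemma elem_lnsq D : (forall x, D x -> 0 < sqnorm x) ->
  elementary D (fun x => ln (sqnorm x)).
Proof. by move=> q0; apply: elem_ln => //; exact: elem_sqnorm. Qed.

Lemma elem_angle D : (forall x, D x -> 0 < sqnorm x) -> elementary D angle.
Proof. by move=> q0; apply: elemM; [exact: elem_cst|exact: elem_lnsq]. Qed.

Lemma elem_vandermonde D : elementary D vandermonde.
Proof. by apply: elem_prod => p _; exact: elem_diff_coord. Qed.

Lemma elem_oscillator D : (forall x, D x -> 0 < sqnorm x) -> elementary D oscillator.
Proof.
move=> q0; apply: elemM; first exact: elem_vandermonde.
apply: elemM; last by apply: elem_cos; exact: elem_angle.
apply: elem_exp; apply: elemM; [exact: elem_cst|exact: elem_lnsq].
Qed.

Lemma cos_angle_gt0 x : osc_domain x -> 0 < cos (angle x).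
Proof. by move=> [_] /=; rewrite ltr_norml; exact: cos_gt0_pihalf. Qed.

Lemma osc_sqnorm_gt0 x : osc_domain x -> 0 < sqnorm x.
Proof. by move=> [xW _]; exact: sqnorm_gt0. Qed.

Lemma elem_osc_radial : elementary osc_domain osc_radial.
Proof.
have eA := elem_angle osc_sqnorm_gt0.
apply: elemM; last by apply: elem_sqnormV => // x [].
rewrite (_ : (fun x => _) =
  cst (-1) \* (cst hardy_exponent \+ (cst k \* ((sin \o angle) \*
   (fun x => (cos (angle x))^-1))))); last by apply/funext => x /=; rewrite mulN1r.
apply: elemM; first exact: elem_cst.
apply: elemD; first exact: elem_cst.
apply: elemM; first exact: elem_cst.
apply: elemM; first exact: elem_sin.
apply: elemV; first exact: elem_cos.
by move=> x Dx; rewrite gt_eqF// cos_angle_gt0.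
Qed.

Lemma vandermonde_gt0 x : W x -> 0 < vandermonde x.
Proof. by move=> xW; apply: prodr_gt0 => p pp; rewrite subr_gt0 xW. Qed.

Lemma oscillator_gt0 x : osc_domain x -> 0 < oscillator x.
Proof.
move=> Dx; have [xW _] := Dx.
by rewrite mulr_gt0 ?vandermonde_gt0// mulr_gt0 ?expR_gt0// cos_angle_gt0.
Qed.

(** Logarithmic differentiation. A pair [(j, l)] contributes at [i = l] and at
    [i = j]; together these are the gaps of [i] to all other indices. *)
Lemma partial_vandermonde i x : W x ->
  differentiable vandermonde x /\
  partial i vandermonde x = vandermonde x * gap_sum i x.
Proof.
move=> xW.
have [|p pp|dV pV] := @partial_prod R d _ (fun p : 'I_d * 'I_d => (p.1 < p.2)%N)
  (fun p y => y ord0 p.2 - y ord0 p.1) i x.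
- by move=> p _; apply: differentiableB; exact: differentiable_coord.
- by rewrite gt_eqF// subr_gt0 xW.
split => //; rewrite [LHS]pV; congr (_ * _).
under eq_bigr do rewrite partial_diff_coord.
rewrite -(pair_big_dep xpredT (fun j l : 'I_d => (j < l)%N)
  (fun j l => ((i == l)%:R - (i == j)%:R) / (x ord0 l - x ord0 j)))/=.
rewrite gap_sumE.
have E (j : 'I_d) :
  \sum_(l < d | (j < l)%N)
     ((i == l)%:R - (i == j)%:R) / (x ord0 l - x ord0 j) =
  (j < i)%N%:R * inv_gap x i j +
     (i == j)%:R * \sum_(l < d | (i < l)%N) inv_gap x i l.
  under eq_bigr do rewrite mulrBl.
  rewrite sumrB; congr (_ + _).
    have [ji|ij] := ltnP j i.
      rewrite (bigD1 i)//= eqxx big1 ?addr0// => l /andP[_ li].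
      by rewrite eq_sym (negPf li) mul0r.
    rewrite mul0r big1// => l jl; have [il|] := eqVneq i l; last by rewrite mul0r.
    by move: ij; rewrite leqNgt il jl.
  have [<-|_] := eqVneq i j; last by rewrite !mul0r big1 ?oppr0// => l _; rewrite mul0r.
  rewrite !mul1r -sumrN; apply: eq_bigr => l _.
  by rewrite /inv_gap mul1r -invrN opprB.
under eq_bigr do rewrite E.
rewrite big_split/= [X in _ + X](bigD1 i)//= eqxx mul1r [X in _ + (_ + X)]big1; last first.
  by move=> j ji; rewrite eq_sym (negPf ji) mul0r.
rewrite addr0 [X in _ + X]big_mkcond/= -big_split/=; apply: eq_bigr => j _.
have [ji|ij|/val_inj ->] := ltngtP j i; rewrite ?mul1r ?mul0r ?add0r ?addr0//.
by rewrite /inv_gap subrr invr0.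
Qed.

Lemma partial_lnsq i x : 0 < sqnorm x ->
  differentiable (fun y => ln (sqnorm y)) x /\
  partial i (fun y => ln (sqnorm y)) x = 2 * x ord0 i / sqnorm x.
Proof.
move=> q0.
have dq := differentiable_sqnorm x.
split; first exact: differentiable_comp1 dq (is_derive1_ln q0).
by rewrite [LHS](partial_comp i dq (is_derive1_ln q0)) partial_sqnorm mulrC.
Qed.

Lemma partial_angle i x : 0 < sqnorm x ->
  differentiable angle x /\ partial i angle x = k * x ord0 i / sqnorm x.
Proof.
move=> q0; have [dl pl] := partial_lnsq i q0.
have [da pa] := partial_cM (k / 2) i dl.
split => //; rewrite [LHS]pa pl; field; exact: lt0r_neq0.
Qed.

Lemma partial_oscillator i x : osc_domain x ->
  differentiable oscillator x /\
  partial i oscillator x = oscillator x * weyl_field osc_radial i x.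
Proof.
move=> Dx; have q0 := osc_sqnorm_gt0 Dx; have [xW _] := Dx.
have c0 := cos_angle_gt0 Dx.
have [dV pV] := partial_vandermonde i xW.
have [dl pl] := partial_lnsq i q0.
have [da pa] := partial_angle i q0.
have [de pe] := partial_cM (- (hardy_exponent / 2)) i dl.
have dE := differentiable_comp1 de (is_derive_expR _).
have pE := partial_comp i de (is_derive_expR _).
have dC := differentiable_comp1 da (is_derive_cos _).
have pC := partial_comp i da (is_derive_cos _).
have dM := differentiableM dE dC.
split; first exact: differentiableM dV dM.
have pM := partialM i dV dM.
rewrite [LHS]pM (partialM i dE dC) pE pC pV pe pl pa /oscillator /weyl_field /osc_radial /=.
rewrite !fctE /=; field; by rewrite !gt_eqF.
Qed.

Lemma open_osc_domain : open osc_domain.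
Proof.
rewrite openE => y [yW ya].
have da : {for y, continuous angle}.
  apply: differentiable_continuous.
  have [] := partial_angle (Ordinal (ltnW d1)) (sqnorm_gt0 d1 yW); by [].
have : \forall z \near y, `|angle z| < pi / 2.
  have : nbhs (angle y) [set t | `|t| < pi / 2].
    have : nbhs (angle y) (ball (angle y) (pi / 2 - `|angle y|)).
      by apply: nbhsx_ballx; rewrite subr_gt0.
    apply: filterS => t; rewrite /ball/= => yt.
    by have := ler_normD (- (angle y - t)) (angle y); rewrite normrN opprB subrK; lra.
  exact: da.
have : nbhs y W by apply: open_nbhs_nbhs; split => //; exact: open_weyl.
by apply: filterS2 => z zW za; split.
Qed.

Lemma partial_osc_radial i x : osc_domain x ->
  partial i osc_radial x =
  (- (k ^+ 2 * (1 + (sin (angle x) / cos (angle x)) ^+ 2)) / sqnorm x ^+ 2 +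
   2 * (hardy_exponent + k * (sin (angle x) / cos (angle x))) / sqnorm x ^+ 2) *
  x ord0 i.
Proof.
move=> Dx; have q0 := osc_sqnorm_gt0 Dx; have c0 := cos_angle_gt0 Dx.
have [da pa] := partial_angle i q0.
have dS := differentiable_comp1 da (is_derive_sin _).
have pS := partial_comp i da (is_derive_sin _).
have dC := differentiable_comp1 da (is_derive_cos _).
have pC := partial_comp i da (is_derive_cos _).
have cn0 : (cos \o angle) x != 0 by rewrite gt_eqF.
have [dCV pCV] := partialV i dC cn0.
have dT := differentiableM dS dCV.
have pT := partialM i dS dCV.
have [dkT pkT] := partial_cM k i dT.
have dc := differentiable_cst hardy_exponent x.
have dB := differentiableD dc dkT.
have pB := partialD i dc dkT.
have [dNB pNB] := partial_cM (-1) i dB.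
have dq := differentiable_sqnorm x.
have [dqV pqV] := partialV i dq (lt0r_neq0 q0).
have pR := partialM i dNB dqV.
rewrite (_ : osc_radial =
  (fun y => -1 * (cst hardy_exponent + (fun y => k * ((sin \o angle) *
    (fun y => ((cos \o angle) y)^-1)) y)) y) \* (fun y => (sqnorm y)^-1)); last first.
  by apply/funext => y; rewrite /osc_radial /= !fctE /= mulN1r.
rewrite [LHS]pR pqV pNB pB pkT pT pCV pC pS pa partial_sqnorm /=.
rewrite /partial derive_cst !fctE /=; field.
by rewrite !gt_eqF.
Qed.

(** Hence [oscillator] solves [- Laplacian v = (a^2 + k^2) v / |x|^2]. In the
    variable [log |x|], the factor [cos (k log |x|)] costs [k^2] more. *)
Lemma riccati_oscillator x : osc_domain x ->
  \sum_i (partial i (weyl_field osc_radial i) x + weyl_field osc_radial i x ^+ 2) =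
  - (hardy_exponent ^+ 2 + k ^+ 2) / sqnorm x.
Proof.
move=> Dx; have q0 := osc_sqnorm_gt0 Dx; have [xW _] := Dx.
have c0 := cos_angle_gt0 Dx.
pose T := hardy_exponent + k * (sin (angle x) / cos (angle x)).
pose m1 := - (k ^+ 2 * (1 + (sin (angle x) / cos (angle x)) ^+ 2)) / sqnorm x ^+ 2
   + 2 * T / sqnorm x ^+ 2.
have oD := open_osc_domain.
have em := elem_osc_radial.
rewrite (@riccati_weyl_field _ _ _ m1)//.
- rewrite /osc_radial -/T /m1.
  have -> : d%:R ^+ 2 = 2 * hardy_exponent + 2 :> R.
    by rewrite /hardy_exponent; field.
  rewrite /T; field; by rewrite !gt_eqF.
- exact: elem_differentiable em Dx.
by move=> i; exact: partial_osc_radial.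
Qed.

End oscillating_solution.

(** * Sharpness of the constant *)

Section sharpness.
Context {R : realType} {d : nat}.
Hypothesis d1 : (1 < d)%N.
Variable k : R.
Hypothesis k0 : 0 < k.
Implicit Types (x : 'rV[R]_d).
Local Notation W := (weyl_chamber R d).
Local Notation D := (@osc_domain R d k).
Local Notation v := (@oscillator R d k).

Lemma closure_ge (T : topologicalType) (K : set T) (g : T -> R) (c : R) (x : T) :
  closure K x -> {for x, continuous g} -> (forall y, K y -> c <= g y) ->
  c <= g x.
Proof.
move=> clK cg Kg; rewrite leNgt; apply/negP => gc.
have : nbhs x [set y | g y < c].
  apply: (cg [set t | t < c]).
  by apply: open_nbhs_nbhs; split; [exact: open_lt|].
by move=> /clK[y [/Kg gy]] /=; rewrite ltNge gy.
Qed.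

Lemma angle_le x : 0 < sqnorm x -> (`|angle k x| <= pi / 2) =
  (expR (- (pi / k)) <= sqnorm x <= expR (pi / k)).
Proof.
move=> q0.
rewrite -{1 2}(lnK (x := sqnorm x)) ?posrE// !ler_expR -ler_norml /angle.
rewrite normrM (gtr0_norm (x := k / 2)) ?divr_gt0//.
rewrite [RHS]ler_pdivlMr// ler_pdivlMr//.
by rewrite mulrAC divfK// mulrC.
Qed.

(** The superlevel set inside the closure of the domain. Its conditions are
    closed, which gives compactness, and they force a point off the boundary
    of the domain, where [oscillator] vanishes. *)
Definition superlevel (e : R) : set 'rV[R]_d :=
  [set x : 'rV[R]_d | [/\ forall i j : 'I_d, (i < j)%N -> x ord0 i <= x ord0 j,
     expR (- (pi / k)) <= sqnorm x, sqnorm x <= expR (pi / k) & e <= v x]].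

Lemma continuous_sqnorm : continuous (@sqnorm R d).
Proof.
apply: smooth_on_continuous; apply: elem_smooth_on; first exact: openT.
exact: elem_sqnorm.
Qed.

Lemma open_sqnorm_gt0 : open [set x : 'rV[R]_d | 0 < sqnorm x].
Proof.
apply: (@open_comp _ _ (@sqnorm R d) [set t | 0 < t]); last exact: open_gt.
by move=> x _; exact: continuous_sqnorm.
Qed.

Lemma superlevel_boxed e : superlevel e `<=` box (1 + expR (pi / k)).
Proof.
move=> x [_ _ qx _] i.
have : x ord0 i ^+ 2 <= expR (pi / k).
  apply: le_trans qx; rewrite /sqnorm (bigD1 i)//= lerDl.
  by apply: sumr_ge0 => j _; exact: sqr_ge0.
rewrite -(real_normK (num_real _)).
move: (`|_|) (expR _) => t c tc; have := sqr_ge0 (t - 1); nra.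
Qed.

Lemma compact_superlevel e : compact (superlevel e).
Proof.
apply: (subclosed_compact _ (@compact_box R d (1 + expR (pi / k)))); last first.
  exact: superlevel_boxed.
move=> x clx.
have lo : expR (- (pi / k)) <= sqnorm x.
  by apply: (closure_ge clx); [exact: continuous_sqnorm|move=> y []].
have q0 : 0 < sqnorm x by apply: lt_le_trans lo; exact: expR_gt0.
split => //.
- move=> i j ij; rewrite -subr_ge0.
  apply: (closure_ge (g := fun y : 'rV[R]_d => y ord0 j - y ord0 i) clx).
    by apply: continuousB; exact: coord_continuous.
  by move=> y [/(_ i j ij)]; rewrite subr_ge0.
- rewrite -lerN2; apply: (closure_ge (g := fun y : 'rV[R]_d => - sqnorm y) clx).
    by apply: continuousN; exact: continuous_sqnorm.
  by move=> y []; rewrite lerN2.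
- apply: (closure_ge clx); last by move=> y [].
  apply: differentiable_continuous.
  by apply: (elem_differentiable open_sqnorm_gt0) => //; exact: elem_oscillator.
Qed.

Lemma superlevel_sub e : 0 < e -> superlevel e `<=` D.
Proof.
move=> e0 x [xle lo hi ev].
have q0 : 0 < sqnorm x by apply: lt_le_trans lo; exact: expR_gt0.
have v0 : 0 < v x by exact: lt_le_trans ev.
split.
  move=> i j ij; rewrite lt_neqAle xle// andbT.
  apply: contraTneq v0 => xij.
  by rewrite /oscillator /vandermonde (bigD1 (i, j))//= xij subrr !mul0r ltxx.
rewrite /= lt_neqAle; apply/andP; split; last by rewrite angle_le// lo.
apply: contraTneq v0 => ax; rewrite /oscillator.
suff -> : cos (angle k x) = 0 by rewrite !mulr0 ltxx.
have [h|h] := lerP 0 (angle k x).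
  by rewrite -(ger0_norm h) ax cos_pihalf.
by rewrite -[angle k x]opprK -(ltr0_norm h) ax cosN cos_pihalf.
Qed.

Lemma sub_superlevel e x : D x -> e <= v x -> superlevel e x.
Proof.
move=> Dx ev; have [xW ax] := Dx; have q0 := osc_sqnorm_gt0 d1 Dx.
have := angle_le q0; rewrite (ltW ax) => /esym/andP[lo hi]; split => //.
by move=> i j ij; exact/ltW/xW.
Qed.

(** Truncation makes the support compact, since it lies in a superlevel set. *)
Definition extremal (e : R) x : R := truncate e (v x).

Lemma elem_osc : elementary D v.
Proof. by apply: elem_oscillator => x; exact: osc_sqnorm_gt0. Qed.

Lemma csupp_extremal e : 0 < e -> csupp_smooth D (extremal e).
Proof.
move=> e0; split.
  apply: elem_smooth_on; first exact: open_osc_domain.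
  pose l := (v \* cst e^-1) \+ cst (-1).
  have el : elementary D l.
    by apply: elemD; [apply: elemM; [exact: elem_osc|exact: elem_cst]|exact: elem_cst].
  exact: (elemM (elem_cst D e) (elemM el (elem_flat 1 el))).
exists (superlevel e); split; [exact: compact_superlevel|exact: superlevel_sub|].
move=> x Dx nx; apply: truncate0 => //; rewrite leNgt; apply/negP => ex.
by apply: nx; apply: sub_superlevel => //; exact: ltW.
Qed.

Lemma osc_domain_boxed : D `<=` box (1 + expR (pi / k)).
Proof.
move=> x Dx; apply: (@superlevel_boxed (v x)); exact: sub_superlevel.
Qed.

Lemma osc_domain_lty : (lebesgue_rV d D < +oo)%E.
Proof.
apply: le_lt_trans (@lebesgue_box_lty R d (1 + expR (pi / k))).
apply: le_measure; rewrite ?inE.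
- by apply: open_measurable_rV; exact: open_osc_domain.
- exact: box_measurable.
- exact: osc_domain_boxed.
Qed.

Let B := @hardy_exponent R d ^+ 2 + k ^+ 2.

Lemma B_gt0 : 0 < B. Proof. by rewrite ltr_wpDl ?sqr_ge0// exprn_gt0. Qed.

Lemma partial_extremal e i x : 0 < e -> D x ->
  partial i (extremal e) x =
    dtruncate e (v x) * (v x * weyl_field (osc_radial k) i x).
Proof.
move=> e0 Dx; have [dv pv] := partial_oscillator d1 i Dx.
by rewrite [LHS](partial_comp i dv (is_derive_truncate _ e0)) pv.
Qed.

(** Up to a divergence the energy density is at most
    [(a^2 + k^2) u v / |x|^2], because [T_e' ^ 2 <= T_e']. Then
    [v <= u + 2 e] and Young's inequality [2 e u <= eta u^2 + e^2 / eta]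
    compare [u v] with [u^2]. *)
Lemma energy_extremal_pointwise (e eta : R) x : 0 < e -> 0 < eta -> D x ->
  \sum_i partial i (extremal e) x ^+ 2 <=
  B * (1 + eta) * (extremal e x ^+ 2 / sqnorm x) +
  B * (e ^+ 2 / eta) * expR (pi / k) +
  \sum_i partial i ((extremal e \* v) \* weyl_field (osc_radial k) i) x.
Proof.
move=> e0 eta0 Dx.
have oD : open D by exact: open_osc_domain.
have q0 := osc_sqnorm_gt0 d1 Dx.
pose F := @weyl_field R d (osc_radial k).
have eF i : elementary D (F i).
  by apply: elem_weyl_field; [move=> y []|exact: elem_osc_radial].
have dF i : differentiable (F i) x by exact: elem_differentiable Dx.
have du : differentiable (extremal e) x.
  by apply: ((csupp_extremal e0).1 [::]).
have dv : differentiable v x by exact: elem_differentiable elem_osc Dx.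
have v0 := oscillator_gt0 Dx.
set p := dtruncate e (v x).
have /andP[p0 p1] := dtruncate_bounds e (v x).
have ph i : partial i ((extremal e \* v) \* F i) x =
    extremal e x * v x * (partial i (F i) x + F i x ^+ 2) + p * v x ^+ 2 * F i x ^+ 2.
  rewrite partialM//; last exact: differentiableM.
  rewrite partialM// partial_extremal// (partial_oscillator d1 i Dx).2 -/p -/(F i) /=.
  by rewrite -/(F i); ring.
under [X in _ <= _ + X]eq_bigr do rewrite ph.
rewrite big_split/= -mulr_sumr (riccati_oscillator d1 Dx) -/B -mulr_sumr.
under eq_bigr do rewrite partial_extremal// -/p mulrA exprMn.
rewrite -mulr_sumr.
set S := \sum_i _.
have S0 : 0 <= S by apply: sumr_ge0 => i _; exact: sqr_ge0.
have h1 : (p * v x) ^+ 2 * S <= p * v x ^+ 2 * S.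
  apply: ler_wpM2r => //; rewrite exprMn; apply: ler_wpM2r; first exact: sqr_ge0.
  by rewrite expr2 ler_piMr.
apply: le_trans h1 _; rewrite addrA lerDr.
set u := extremal e x.
have u0 : 0 <= u by exact: truncate_ge0.
have hu : v x - 2 * e <= u by exact: truncate_ge.
have qi : (sqnorm x)^-1 <= expR (pi / k).
  have := angle_le q0; have [_ /ltW ->] := Dx => /esym/andP[+ _].
  rewrite expRN => lo; rewrite -[leRHS]invrK lef_pV2 ?posrE// invr_gt0 expR_gt0//.
have hy : u * v x <= (1 + eta) * u ^+ 2 + e ^+ 2 / eta.
  have : 0 <= eta^-1 * (eta * u - e) ^+ 2.
    by rewrite mulr_ge0 ?invr_ge0 ?sqr_ge0// (ltW eta0).
  have -> : eta^-1 * (eta * u - e) ^+ 2 = eta * u ^+ 2 - 2 * u * e + e ^+ 2 / eta.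
    by field; rewrite gt_eqF.
  have : u * (v x - 2 * e) <= u * u by apply: ler_wpM2l.
  move: (e ^+ 2 / eta) => z; nra.
have hz : 0 <= e ^+ 2 / eta by rewrite divr_ge0 ?sqr_ge0// (ltW eta0).
have B0 := ltW B_gt0.
have qi0 : 0 <= (sqnorm x)^-1 by rewrite invr_ge0 (ltW q0).
have h2 : B * (u * v x) * (sqnorm x)^-1 <=
    B * ((1 + eta) * u ^+ 2 + e ^+ 2 / eta) * (sqnorm x)^-1.
  by apply: ler_wpM2r => //; apply: ler_wpM2l.
have h3 : B * (e ^+ 2 / eta) * (sqnorm x)^-1 <= B * (e ^+ 2 / eta) * expR (pi / k).
  by apply: ler_wpM2l => //; exact: mulr_ge0.
move: h2 h3; move: (e ^+ 2 / eta) (expR _) (sqnorm x)^-1 => z E q h2 h3.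
nra.
Qed.

Lemma csupp_extremal_sqr e : 0 < e ->
  csupp_smooth D (fun x => extremal e x ^+ 2 / sqnorm x).
Proof.
move=> e0; have cu := csupp_extremal e0.
have -> : (fun x => extremal e x ^+ 2 / sqnorm x) =
  extremal e \* (extremal e \* (fun x => (sqnorm x)^-1)).
  by apply/funext => x /=; rewrite expr2 mulrA.
apply: csuppM => //; first exact: open_osc_domain.
apply: elemM; first by apply: elem_smooth; exact: cu.1.
by apply: elem_sqnormV => // x [].
Qed.

Lemma energy_extremal (e eta : R) : 0 < e -> 0 < eta ->
  (\int[lebesgue_rV d]_(x in D) (\sum_i partial i (extremal e) x ^+ 2)%:E <=
   (B * (1 + eta))%:E *
     \int[lebesgue_rV d]_(x in D) (extremal e x ^+ 2 / sqnorm x)%:E +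
   (B * (e ^+ 2 / eta) * expR (pi / k))%:E * lebesgue_rV d D)%E.
Proof.
move=> e0 eta0.
have oD : open D by exact: open_osc_domain.
have mD := open_measurable_rV oD.
have cu := csupp_extremal e0.
pose h i := (extremal e \* v) \* @weyl_field R d (osc_radial k) i.
have ch i : csupp_smooth D (h i).
  apply: csuppM => //; first by apply: csuppM => //; exact: elem_osc.
  by apply: elem_weyl_field; [move=> y []|exact: elem_osc_radial].
have div0 := divergence_theorem_csupp oD ch.
have idiv : (lebesgue_rV d).-integrable D (fun x => (\sum_i partial i (h i) x)%:E).
  apply: (csupp_integrable (f := fun x => \sum_i partial i (h i) x)) => //.
  by apply: csupp_sum => // i; exact: csupp_partial.
have iq := csupp_integrable oD (csupp_extremal_sqr e0).
set c := B * (e ^+ 2 / eta) * expR (pi / k).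
have ic : (lebesgue_rV d).-integrable D (EFin \o cst c).
  apply: measurable_bounded_integrable => //; first exact: osc_domain_lty.
  exact: bounded_cst.
rewrite -integralZl// -integral_cst// -integralD//; last exact: integrableZl.
have iqc : (lebesgue_rV d).-integrable D
    (fun x => (B * (1 + eta))%:E * (extremal e x ^+ 2 / sqnorm x)%:E + c%:E)%E.
  by apply: integrableD => //; exact: integrableZl.
rewrite -[leRHS]adde0 -div0 -integralD//.
apply: le_integral => //.
- apply: (csupp_integrable (f := fun x => \sum_i partial i (extremal e) x ^+ 2)) => //.
  apply: csupp_sum => // i.
  have -> : (fun x => partial i (extremal e) x ^+ 2) =
      partial i (extremal e) \* partial i (extremal e).
    by apply/funext => x; rewrite expr2.
  have cp := csupp_partial i oD cu.
  by apply: csuppM => //; apply: elem_smooth; exact: cp.1.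
- exact: integrableD.
move=> x; rewrite inE => Dx; rewrite -EFinM -!EFinD lee_fin.
exact: energy_extremal_pointwise.
Qed.

(** On the unit sphere the angle is 0. *)
Lemma osc_domain_nonempty : exists x, D x.
Proof.
pose y : 'rV[R]_d := \row_i (i.+1)%:R.
have yW : W y by move=> i j ij; rewrite !mxE ltr_nat ltnS.
have q0 := sqnorm_gt0 d1 yW.
have s0 : 0 < (Num.sqrt (sqnorm y))^-1 by rewrite invr_gt0 sqrtr_gt0.
exists ((Num.sqrt (sqnorm y))^-1 *: y); split.
  move=> i j ij; rewrite ![in X in X < _]mxE ![in X in _ < X]mxE.
  by rewrite ltr_pM2l// ltr_nat ltnS.
rewrite /= /angle (_ : sqnorm _ = 1); last first.
  rewrite /sqnorm; under eq_bigr do rewrite mxE exprMn.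
  rewrite -mulr_sumr -/(sqnorm y) exprVn sqr_sqrtr ?(ltW q0)// mulVf//.
  exact: lt0r_neq0.
by rewrite ln1 mulr0 normr0 divr_gt0// pi_gt0.
Qed.

(** Near a point [x0] of the domain [oscillator] exceeds half its value there,
    and truncation at a level [e <= v x0 / 8] leaves at least a quarter of it. *)
Lemma extremal_mass : exists2 c : R, 0 < c & exists2 e0 : R, 0 < e0 &
  forall e, 0 < e -> e <= e0 ->
  (c%:E <= \int[lebesgue_rV d]_(x in D) (extremal e x ^+ 2 / sqnorm x)%:E)%E.
Proof.
have oD : open D by exact: open_osc_domain.
have mD := open_measurable_rV oD.
have [x0 Dx0] := osc_domain_nonempty.
have v0 := oscillator_gt0 Dx0.
have /nbhs_boxP[r r0 rD] : nbhs x0 (D `&` [set y | v x0 / 2 < v y]).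
  apply: filterI; first exact: open_nbhs_nbhs.
  have cv : {for x0, continuous v}.
    by apply/differentiable_continuous/(elem_differentiable oD elem_osc).
  apply: (cv [set t | v x0 / 2 < t]).
  apply: open_nbhs_nbhs; split; first exact: open_gt.
  by rewrite /=; lra.
pose A (i : 'I_d) : set (measurableTypeR R) :=
  `](x0 ord0 i - r), (x0 ord0 i + r)[%classic.
pose Q : set 'rV[R]_d := [set y | forall i, A i (y ord0 i)].
have QD : Q `<=` D `&` [set y | v x0 / 2 < v y].
  move=> y Qy; apply: rD => i; have := Qy i; rewrite /A/= in_itv/= ltr_norml.
  by move=> /andP[? ?]; apply/andP; split; lra.
have Qv : lebesgue_rV d Q = ((2 * r) ^+ d)%:E.
  rewrite /Q lebesgue_rV_box//; last by move=> i; exact: measurable_itv.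
  rewrite (eq_bigr (fun=> (2 * r)%:E)); last first.
    move=> i _; rewrite lebesgue_measure_itv/= lte_fin ifT; last by lra.
    by rewrite -EFinB; congr EFin; ring.
  by rewrite prodEFin prodr_const card_ord.
have mQ : measurable Q by apply: measurable_rV_prod => i; exact: measurable_itv.
pose m := (v x0 / 4) ^+ 2 * expR (- (pi / k)).
have m0 : 0 < m by rewrite mulr_gt0 ?expR_gt0// exprn_gt0// divr_gt0.
exists (m * (2 * r) ^+ d); first by rewrite mulr_gt0// exprn_gt0// mulr_gt0.
exists (v x0 / 8); first by rewrite divr_gt0.
move=> e e0 ev.
have iq := csupp_integrable oD (csupp_extremal_sqr e0).
have mq := measurable_int _ iq.
have q0 x : D x -> (0 <= (extremal e x ^+ 2 / sqnorm x)%:E)%E.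
  by move=> Dx; rewrite lee_fin divr_ge0 ?sqr_ge0// ltW// (osc_sqnorm_gt0 d1 Dx).
apply: (@le_trans _ _ (\int[lebesgue_rV d]_(x in Q)
  (extremal e x ^+ 2 / sqnorm x)%:E)%E).
  rewrite EFinM -Qv -integral_cst//; apply: ge0_le_integral => //.
  - by move=> x _; rewrite lee_fin ltW.
  - by apply: measurable_funS mq => // x /QD[].
  move=> x /QD -[Dx /= vx]; rewrite lee_fin /m.
  have h : v x0 / 4 <= extremal e x.
    by apply: le_trans (truncate_ge _ e0); lra.
  apply: ler_pM; rewrite ?sqr_ge0 ?expR_ge0//.
    by rewrite ler_pXn2r// nnegrE ?truncate_ge0// divr_ge0// (ltW v0).
  have qx := osc_sqnorm_gt0 d1 Dx.
  have := angle_le qx; have [_ /ltW ->] := Dx => /esym/andP[_ hi].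
  by rewrite expRN lef_pV2// posrE expR_gt0.
by apply: ge0_subset_integral => // x /QD[].
Qed.

(** The level [e] is so small that the error [e^2 M] of the energy estimate is
    absorbed by half of the gap between [C] and [a^2 + k^2]. *)
Lemma hardy_weyl_fails (C : R) : @hardy_exponent R d ^+ 2 + k ^+ 2 < C ->
  exists2 u : 'rV[R]_d -> R[i], C0oo W u &
  ~ (C%:E * \int[lebesgue_rV d]_(x in W)
              (ComplexField.Normc.normc (u x) ^+ 2 / enorm x ^+ 2)%:E
     <= \int[lebesgue_rV d]_(x in W) (gradnorm u x ^+ 2)%:E)%E.
Proof.
rewrite -/B => BC.
have oD : open D by exact: open_osc_domain.
have DW : D `<=` W by move=> x [].
have B0 := B_gt0.
(* This [eta] makes [B (1 + eta)] the midpoint of [B] and [C]. *)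
pose eta := (C - B) / (2 * B).
have eta0 : 0 < eta by rewrite divr_gt0 ?subr_gt0// mulr_gt0.
have Beta : B * (1 + eta) = (C + B) / 2 by rewrite /eta; field; exact: lt0r_neq0.
have [c c0 [e1 e10 mass]] := extremal_mass.
have PE : lebesgue_rV d D = (fine (lebesgue_rV d D))%:E.
  by rewrite fineK// ge0_fin_numE// osc_domain_lty.
pose P := fine (lebesgue_rV d D).
have P0 : 0 <= P by rewrite fine_ge0.
pose M := B / eta * expR (pi / k) * P.
have M0 : 0 <= M.
  apply: mulr_ge0 => //; apply: mulr_ge0; last exact: expR_ge0.
  by apply: divr_ge0; exact: ltW.
pose dl := (C - B) / 2 * c.
have dl0 : 0 < dl by rewrite mulr_gt0// divr_gt0// subr_gt0.
pose e := Num.min e1 (Num.min 1 (dl / (M + 1))).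
have M10 : 0 < M + 1 by rewrite ltr_wpDl.
have e0 : 0 < e by rewrite !lt_min e10 ltr01 divr_gt0.
have ee1 : e <= e1 by rewrite /e ge_min lexx.
have e_le1 : e <= 1 by rewrite /e !ge_min lexx orbT.
have e_dl : e * (M + 1) <= dl by rewrite -ler_pdivlMr// /e !ge_min lexx !orbT.
have cu := csupp_extremal e0.
pose U := zero_ext D (extremal e).
have sU := zero_ext_smooth oD cu.
exists (fun x => (U x +i* 0)%C).
  have [_ [K [cK KD u0]]] := cu.
  have sub : closure [set x | (U x +i* 0)%C != 0] `<=` K.
    have clK : closed K by apply: compact_closed cK; exact: norm_hausdorff.
    rewrite [X in _ `<=` X](closure_id K).1//; apply: closureS => x /=.
    apply: contra_neqP => nK; congr (_ +i* _)%C.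
    rewrite /U /zero_ext; case: ifPn => //; rewrite inE => Dx.
    exact: u0.
  split.
  - split; first by move=> s x; exact: sU.
    move=> s x; apply: (@elem_smooth_on _ _ setT) => //; first exact: openT.
    exact: elem_cst.
  - by apply: subclosed_compact cK sub; exact: closed_closure.
  - by move=> x /sub/KD/DW.
rewrite (_ : (\int[_]_(x in W) _)%E =
   \int[lebesgue_rV d]_(x in D) (extremal e x ^+ 2 / sqnorm x)%:E)%E; last first.
  rewrite -(integral_zero_ext _ DW); apply: eq_integral => x _.
  rewrite enorm_sqr normc_sqr /= expr0n/= addr0 /U /zero_ext.
  by case: ifP => // _; rewrite expr0n/= mul0r.
rewrite [X in (_ <= X)%E](_ : _ = \int[lebesgue_rV d]_(x in D)
    (\sum_i partial i (extremal e) x ^+ 2)%:E)%E; last first.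
  rewrite -(integral_zero_ext _ DW); apply: eq_integral => x _; congr EFin.
  rewrite gradnorm_sqr /= /zero_ext; case: ifPn => xD; last first.
    apply: big1 => i _; rewrite [X in X ^+ 2 + _]partial_zero_ext// /zero_ext (negPf xD).
    by rewrite /partial derive_cst expr0n/= addr0.
  apply: eq_bigr => i _; rewrite [X in X ^+ 2 + _]partial_zero_ext// /zero_ext xD.
  by rewrite /partial derive_cst expr0n/= addr0.
move=> hardyC.
have := le_trans hardyC (energy_extremal e0 eta0).
have mI := mass _ e0 ee1.
have iq := csupp_integrable oD (csupp_extremal_sqr e0).
have fI := integrable_fin_num (open_measurable_rV oD) iq.
rewrite -(fineK fI) in mI *.
move: mI; rewrite PE -!EFinM -EFinD !lee_fin Beta -/P.
set I := fine _ => cI.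
have -> : B * (e ^+ 2 / eta) * expR (pi / k) * P = e ^+ 2 * M.
  by rewrite /M; field; exact: lt0r_neq0.
apply/negP; rewrite -ltNge.
have h1 : e ^+ 2 * M <= e * M.
  by apply: ler_wpM2r => //; rewrite expr2 ler_piMr// ltW.
have h2 : dl <= (C - B) / 2 * I.
  by apply: ler_wpM2l => //; rewrite divr_ge0// subr_ge0 ltW.
lra.
Qed.

End sharpness.

Unset Implicit Arguments.

Theorem theorem2p2 (R : realType) (d : nat) (hd : (2 <= d)%N) :
  let Omega := weyl_chamber R d in
  let hardy (C : R) (u : 'rV[R]_d -> R[i]) : Prop :=
    (C%:E * \int[lebesgue_rV d]_(x in Omega)
              (ComplexField.Normc.normc (u x) ^+ 2 / enorm x ^+ 2)%:E
     <= \int[lebesgue_rV d]_(x in Omega) (gradnorm u x ^+ 2)%:E)%E in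
  let C0 : R := (d%:R ^+ 2 - 2) ^+ 2 / 4 in
  (forall u : 'rV[R]_d -> R[i], C0oo Omega u -> hardy C0 u) /\
  (forall C : R, C0 < C ->
     exists2 u : 'rV[R]_d -> R[i], C0oo Omega u & ~ hardy C u).
Proof.
move=> Omega hardy C0; split; first exact: hardy_weyl.
move=> C C0C.
have C0E : C0 = @hardy_exponent R d ^+ 2 by rewrite /C0 /hardy_exponent; field.
(* With [k ^ 2] equal to half the gap, [a^2 + k^2] is still below [C]. *)
have k2 : 0 < (C - C0) / 2 by rewrite divr_gt0// subr_gt0.
apply: (@hardy_weyl_fails R d hd (Num.sqrt ((C - C0) / 2))).
  by rewrite sqrtr_gt0.
by rewrite sqr_sqrtr ?(ltW k2)// -C0E; lra.
Qed.
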